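(* Consider $n$ agents with single-integrator dynamics $\dot{x}_i(t)=u_i(t)$, $x_i(t)\in\mathbb{R}^m$, $i\in\{1,\dots,n\}$, communicating over a time-varying undirected graph $\mathcal{G}(t)$ with neighbor sets $N_i(t)$. Let each local objective $f_i:\mathbb{R}^m\to\mathbb{R}$ be convex and differentiable with $\nabla f_i$ continuous. Assume: (i) $\mathcal{G}(t)$ is undirected and connected for all $t\ge 0$; (ii) for every $i$, the set $X_i=\{s\in\mathbb{R}^m:\nabla f_i(s)=0\}$ is nonempty and bounded; (iii) the length of the time interval between any two contiguous switching times of $\mathcal{G}(t)$ is no smaller than a given constant $d_w>0$. Apply the control law $$u_i(t)=\sum_{j\in N_i(t)}\frac{q_{ij}(t)\,[x_j(t)-x_i(t)]}{\|x_j(t)-x_i(t)\|}-\nabla f_i(x_i(t)),$$ $$\dot q_{ij}(t)=\begin{cases}\mathrm{sgn}(\|x_j(t)-x_i(t)\|), & (i,j)\text{ an edge of }\mathcal{G}(t),\\ 0,&\text{otherwise},\end{cases}\qquad q_{ij}(0)=q_{ji}(0)=0,$$ with solutions understood in the Filippov sense. Then all agents reach consensus in finite time (there is $T\ge0$ with $x_i(t)=x_j(t)$ for all $i,j$ and all $t\ge T$), and the team objective is minimized asymptotically: with $x^*(t)=\frac1n\sum_{i=1}^n x_i(t)$, $$\lim_{t\to+\infty}\Big[\sum_{i=1}^n f_i(x^*(t))-\min_{s\in\mathbb{R}^m}\sum_{i=1}^n f_i(s)\Big]=0,$$ i.e. the agents asymptotically solve $\min \sum_{i=1}^n f_i(x_i)$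 subject to $x_i=x_j$ for all $i,j$.
   Context: $\mathcal{G}(t)$ is an undirected graph on node set $\{1,\dots,n\}$; $N_i(t)$ is the set of neighbors of agent $i$ in $\mathcal{G}(t)$. A graph is connected if there is a path between every pair of nodes. $\mathrm{sgn}$ is the sign function (so $\mathrm{sgn}(0)=0$, $\mathrm{sgn}(r)=1$ for $r>0$). The minimizer set $X=\{s:\sum_i\nabla f_i(s)=0\}$ of the team function $\sum_i f_i$ is nonempty and bounded under the hypotheses. The right-hand side is discontinuous, so trajectories are Filippov solutions. *)

(* Defs.v *)
From Stdlib Require Import Reals List.
From mathcomp Require Import all_boot.

Set Implicit Arguments.
Unset Strict Implicit.

Local Open Scope R_scope.

Definition dot {I : finType} (u v : I -> R) : R :=
  \big[Rplus/0]_(i : I) (u i * v i).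

Definition norm {I : finType} (u : I -> R) : R := sqrt (dot u u).

Definition vsub {I : finType} (u v : I -> R) : I -> R := fun i => u i - v i.

Definition box_vol {I : finType} (a b : I -> R) : R :=
  \big[Rmult/1]_(i : I) (b i - a i).

Definition in_box {I : finType} (a b z : I -> R) : Prop :=
  forall i, a i <= z i <= b i.

Definition null_set {I : finType} (N : (I -> R) -> Prop) : Prop :=
  forall eps, 0 < eps ->
    exists a b : nat -> I -> R,
      (forall k i, a k i <= b k i) /\
      (forall z, N z -> exists k, in_box (a k) (b k) z) /\
      (forall K, sum_f_R0 (fun k => box_vol (a k) (b k)) K <= eps).

Definition null_set_R (N : R -> Prop) : Prop :=
  forall eps, 0 < eps ->
    exists a b : nat -> R,
      (forall k, a k <= b k) /\
      (forall t, N t -> exists k, a k <= t <= b k) /\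
      (forall K, sum_f_R0 (fun k => b k - a k) K <= eps).

(* Closed convex hull (intersection of closed half-spaces)              *)

Definition clconv {I : finType} (S : (I -> R) -> Prop) (y : I -> R) : Prop :=
  forall (a : I -> R) (b : R),
    (forall s, S s -> dot a s <= b) -> dot a y <= b.

Definition filippov_set {I : finType} (F : (I -> R) -> (I -> R))
    (z v : I -> R) : Prop :=
  forall delta, 0 < delta -> forall N : (I -> R) -> Prop, null_set N ->
    clconv (fun w => exists y, norm (vsub y z) < delta /\ ~ N y /\ w = F y) v.

Fixpoint intervals_in (a b : R) (l : list (R * R)) : Prop :=
  match l with
  | nil => True
  | (c, d) :: l' => a <= c /\ c <= d /\ d <= b /\ intervals_in d b l'
  end.

Definition total_len (l : list (R * R)) : R :=
  fold_right (fun p acc => (snd p - fst p) + acc) 0 l.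

Definition total_var (g : R -> R) (l : list (R * R)) : R :=
  fold_right (fun p acc => Rabs (g (snd p) - g (fst p)) + acc) 0 l.

Definition abs_cont_on (g : R -> R) (a b : R) : Prop :=
  forall eps, 0 < eps -> exists delta, 0 < delta /\
    forall l, intervals_in a b l -> total_len l < delta -> total_var g l < eps.

Definition filippov_solution {I : finType} (f : R -> (I -> R) -> (I -> R))
    (z : R -> I -> R) : Prop :=
  (forall i T, 0 <= T -> abs_cont_on (fun t => z t i) 0 T) /\
  null_set_R (fun t => 0 <= t /\
     ~ (exists v : I -> R,
          (forall i, derivable_pt_lim (fun s => z s i) t (v i)) /\
          filippov_set (f t) (z t) v)).

Definition convex_fun {I : finType} (F : (I -> R) -> R) : Prop :=
  forall (u v : I -> R) (l : R), 0 <= l <= 1 ->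
    F (fun k => l * u k + (1 - l) * v k) <= l * F u + (1 - l) * F v.

Definition has_gradient {I : finType} (F : (I -> R) -> R)
    (DF : (I -> R) -> (I -> R)) : Prop :=
  forall u eps, 0 < eps -> exists delta, 0 < delta /\
    forall v, norm (vsub v u) < delta ->
      Rabs (F v - F u - dot (DF u) (vsub v u)) <= eps * norm (vsub v u).

Definition continuous_map {I J : finType} (H : (I -> R) -> (J -> R)) : Prop :=
  forall u eps, 0 < eps -> exists delta, 0 < delta /\
    forall v, norm (vsub v u) < delta -> norm (vsub (H v) (H u)) < eps.

Definition bounded_set {I : finType} (S : (I -> R) -> Prop) : Prop :=
  exists M, forall s, S s -> norm s <= M.

Definition dwell_time {n : nat} (G : R -> rel 'I_n) (dw : R) : Prop :=
  exists tau : nat -> R,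
    tau O = 0 /\
    (forall k, dw <= tau (S k) - tau k) /\
    (forall k t, tau k <= t < tau (S k) -> forall i j, G t i j = G (tau k) i j).

Definition sgn (r : R) : R :=
  if Rlt_dec 0 r then 1 else if Rlt_dec r 0 then -1 else 0.

(* state: positions x_{i,k} (agent i, coordinate k) and gains q_{ij} *)
Definition St (n m : nat) : finType := (('I_n * 'I_m) + ('I_n * 'I_n))%type.

Definition pack {n m : nat} (x : 'I_n -> 'I_m -> R) (q : 'I_n -> 'I_n -> R)
    : St n m -> R :=
  fun c => match c with
           | inl p => x p.1 p.2
           | inr p => q p.1 p.2
           end.

Definition pos_of {n m : nat} (z : St n m -> R) (i : 'I_n) : 'I_m -> R :=
  fun k => z (inl (i, k)).

Definition gain_of {n m : nat} (z : St n m -> R) (i j : 'I_n) : R :=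
  z (inr (i, j)).

Definition closed_loop {n m : nat} (G : R -> rel 'I_n)
    (g : 'I_n -> ('I_m -> R) -> ('I_m -> R)) (t : R) (z : St n m -> R)
    : St n m -> R :=
  fun c => match c with
   | inl p =>
       let i := p.1 in let k := p.2 in
       \big[Rplus/0]_(j | G t i j)
          (gain_of z i j * (pos_of z j k - pos_of z i k)
             / norm (vsub (pos_of z j) (pos_of z i)))
       - g i (pos_of z i) k
   | inr p =>
       let i := p.1 in let j := p.2 in
       if G t i j then sgn (norm (vsub (pos_of z j) (pos_of z i))) else 0
   end.

Definition avg {n m : nat} (x : 'I_n -> 'I_m -> R) : 'I_m -> R :=
  fun k => / INR n * \big[Rplus/0]_(i : 'I_n) x i k.

Definition team {n m : nat} (f : 'I_n -> ('I_m -> R) -> R) (s : 'I_m -> R) : R :=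
  \big[Rplus/0]_(i : 'I_n) f i s.

(* Main.v *)
(** The Filippov regularization ignores null sets, in particular the set where
    two agents coincide, so the gain of every edge grows at unit speed as long
    as the edge is present, even at consensus. With the dwell time, the gain of
    each edge that keeps reappearing therefore exceeds any bound.

    As the gains are symmetric and nonnegative, the coupling terms only dissipate
    sum_i |x_i|^2, while the gradient terms decrease it far from the origin: a
    convex function with a nonempty bounded set of minimizers grows at least
    linearly. Hence the agents, and their gradients, stay bounded. Once the gains
    of the present edges dominate the gradients and the graph is connected, the
    square root of sum_i |x_i - avg|^2 decreases at speed at least 1, which gives
    consensus in finite time. From then on avg follows the gradient flow of the
    team function divided by n, whose optimality gap is O(1/t).

    Differential inequalities are integrated by the fact that an absolutely
    continuous function with derivative at most c almost everywhere grows by at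
    most c(b - a) on [a, b]. *)

From HB Require Import structures.
Require Import Defs.
From Stdlib Require Import Reals Lra Classical ClassicalEpsilon FunctionalExtensionality.
From mathcomp Require Import all_boot.

Set Implicit Arguments.
Unset Strict Implicit.

Local Open Scope R_scope.

(** * Finite sums and products of reals as big operators *)

Fact RplusA : associative Rplus. Proof. by move=> x y z; ring. Qed.
Fact RmultA : associative Rmult. Proof. by move=> x y z; ring. Qed.
Fact RmultDl : left_distributive Rmult Rplus. Proof. by move=> x y z; ring. Qed.
Fact RmultDr : right_distributive Rmult Rplus. Proof. by move=> x y z; ring. Qed.

HB.instance Definition _ := Monoid.isComLaw.Build R 0 Rplus RplusA Rplus_comm Rplus_0_l.
HB.instance Definition _ := Monoid.isComLaw.Build R 1 Rmult RmultA Rmult_comm Rmult_1_l.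
HB.instance Definition _ := Monoid.isMulLaw.Build R 0 Rmult Rmult_0_l Rmult_0_r.
HB.instance Definition _ := Monoid.isAddLaw.Build R Rmult Rplus RmultDl RmultDr.

Section Sums.
Variables (I : finType).
Implicit Types (P : pred I) (F H : I -> R).

Lemma sumR_le P F H : (forall i, P i -> F i <= H i) ->
  \big[Rplus/0]_(i | P i) F i <= \big[Rplus/0]_(i | P i) H i.
Proof.
by move=> FH; elim/big_ind2: _ => // *; lra.
Qed.

Lemma sumR_ge0 P F : (forall i, P i -> 0 <= F i) -> 0 <= \big[Rplus/0]_(i | P i) F i.
Proof. by move=> F0; elim/big_ind: _ => // *; lra. Qed.

Lemma sumR_opp P F :
  \big[Rplus/0]_(i | P i) (- F i) = - \big[Rplus/0]_(i | P i) F i.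
Proof. by elim/big_rec2: _ => [|i y1 y2 _ ->]; lra. Qed.

Lemma sumR_sub P F H :
  \big[Rplus/0]_(i | P i) (F i - H i) =
  \big[Rplus/0]_(i | P i) F i - \big[Rplus/0]_(i | P i) H i.
Proof. by rewrite big_split sumR_opp. Qed.

Lemma sumR_const (c : R) : \big[Rplus/0]_(i : I) c = INR #|I| * c.
Proof.
rewrite big_const; elim: #|I| => [|n IH]; first by rewrite /=; ring.
by rewrite iterS IH S_INR; ring.
Qed.

Lemma sumR_abs P F :
  Rabs (\big[Rplus/0]_(i | P i) F i) <= \big[Rplus/0]_(i | P i) Rabs (F i).
Proof.
elim/big_rec2: _ => [|i y1 y2 _ H]; first by rewrite Rabs_R0; lra.
by have := Rabs_triang (F i) y2; lra.
Qed.

Lemma sumR_term P F i : P i -> (forall i, P i -> 0 <= F i) ->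
  F i <= \big[Rplus/0]_(i | P i) F i.
Proof.
move=> Pi F0; rewrite (bigD1 i) //=.
have := @sumR_ge0 (fun j => P j && (j != i)) F _; case=> [j /andP[Pj _]|*|*]; try lra.
exact: F0.
Qed.

(** Makes a threshold that depends on the index uniform: the minimum is taken along the enumeration,
    and downward closure lets it replace each individual threshold. *)
Lemma fin_min (Q : I -> R -> Prop) :
  (forall i, exists2 d, 0 < d & Q i d) ->
  (forall i d d', Q i d -> 0 < d' <= d -> Q i d') ->
  exists2 d, 0 < d & forall i, Q i d.
Proof.
move=> ex down.
have [d d0 Hd] : exists2 d, 0 < d & forall i, i \in enum I -> Q i d.
  elim: (enum I) => [|i s [d d0 Hd]]; first by exists 1; [lra|].
  have [e e0 He] := ex i; exists (Rmin d e); first exact: Rmin_glb_lt.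
  have m0 : 0 < Rmin d e by exact: Rmin_glb_lt.
  move=> j; rewrite inE => /orP[/eqP-> | js].
    by apply: down He _; have := Rmin_r d e; lra.
  by apply: down (Hd _ js) _; have := Rmin_l d e; lra.
by exists d => // i; apply: Hd; rewrite mem_enum.
Qed.

Lemma fin_max (Q : I -> R -> Prop) :
  (forall i, exists d, Q i d) ->
  (forall i d d', Q i d -> d <= d' -> Q i d') ->
  exists d, forall i, Q i d.
Proof.
move=> ex up.
have [d Hd] : exists d, forall i, i \in enum I -> Q i d.
  elim: (enum I) => [|i s [d Hd]]; first by exists 1.
  have [e He] := ex i; exists (Rmax d e).
  move=> j; rewrite inE => /orP[/eqP-> | js].
    by apply: up He _; have := Rmax_r d e; lra.
  by apply: up (Hd _ js) _; have := Rmax_l d e; lra.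
by exists d => i; apply: Hd; rewrite mem_enum.
Qed.

End Sums.

(** * Euclidean inner product and norm *)

Section Norm.
Variable I : finType.
Implicit Types u v w : I -> R.

Lemma dotC u v : dot u v = dot v u.
Proof. by apply: eq_bigr => i _; ring. Qed.

Lemma dotDr u v w : dot u (fun i => v i + w i) = dot u v + dot u w.
Proof. by rewrite /dot -big_split; apply: eq_bigr => i _ /=; ring. Qed.

Lemma dotZr u (c : R) v : dot u (fun i => c * v i) = c * dot u v.
Proof. by rewrite /dot big_distrr; apply: eq_bigr => i _ /=; ring. Qed.

Lemma dotBr u v w : dot u (vsub v w) = dot u v - dot u w.
Proof. by rewrite /dot -sumR_sub; apply: eq_bigr => i _; rewrite /vsub; ring. Qed.

Lemma dotZl (c : R) u v : dot (fun i => c * u i) v = c * dot u v.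
Proof. by rewrite dotC dotZr dotC. Qed.

Lemma dotDl u v w : dot (fun i => v i + w i) u = dot v u + dot w u.
Proof. by rewrite dotC dotDr !(dotC u). Qed.

Lemma dotBl u v w : dot (vsub v w) u = dot v u - dot w u.
Proof. by rewrite dotC dotBr !(dotC u). Qed.

Lemma dot_sumr (J : finType) u (V : J -> I -> R) :
  dot u (fun i => \big[Rplus/0]_j V j i) = \big[Rplus/0]_j dot u (V j).
Proof.
rewrite /dot exchange_big; apply: eq_bigr => i _ /=.
by rewrite big_distrr.
Qed.

Lemma eq_dot u u' v v' : u =1 u' -> v =1 v' -> dot u v = dot u' v'.
Proof. by move=> eu ev; apply: eq_bigr => i _; rewrite eu ev. Qed.

Lemma eq_norm u v : u =1 v -> norm u = norm v.
Proof. by move=> e; rewrite /norm (eq_dot e e). Qed.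

Lemma dot_ge0 u : 0 <= dot u u.
Proof. by apply: sumR_ge0 => i _; nra. Qed.

Lemma norm_ge0 u : 0 <= norm u.
Proof. exact: sqrt_pos. Qed.

Lemma norm_sqr u : norm u * norm u = dot u u.
Proof. exact/sqrt_def/dot_ge0. Qed.

Lemma norm_coord u i : Rabs (u i) <= norm u.
Proof.
rewrite -sqrt_Rsqr_abs; apply: sqrt_le_1_alt.
by apply: (@sumR_term _ xpredT (fun i => u i * u i)) => // j _; nra.
Qed.

Lemma norm0P u : norm u = 0 <-> forall i, u i = 0.
Proof.
split=> [u0 i|u0].
  have := norm_coord u i; rewrite u0 => ui.
  by have := Rabs_pos (u i); split_Rabs; lra.
by rewrite /norm /dot big1 ?sqrt_0 // => i _; rewrite u0; ring.
Qed.

Lemma normZ (c : R) u : norm (fun i => c * u i) = Rabs c * norm u.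
Proof.
rewrite /norm dotZl dotZr -Rmult_assoc sqrt_mult_alt; last by nra.
by rewrite -/(Rsqr c) sqrt_Rsqr_abs.
Qed.

Lemma norm_sym u v : norm (vsub u v) = norm (vsub v u).
Proof.
rewrite (@eq_norm _ (fun i => -1 * vsub v u i)); last by move=> i; rewrite /vsub; ring.
by rewrite normZ Rabs_Ropp Rabs_R1; ring.
Qed.

Lemma cauchy_schwarz u v : dot u v <= norm u * norm v.
Proof.
have [u0|u0] := Req_dec (norm u) 0.
  rewrite u0 Rmult_0_l; move/norm0P: u0 => u0.
  by rewrite /dot big1; [lra | move=> i _; rewrite u0; ring].
have pu := norm_ge0 u; have pv := norm_ge0 v.
(* The squared norm of (u.u) v - (u.v) u is a^2 (a^2 b^2 - d^2), with a = |u|, b = |v| and d = u.v;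
   as a is nonzero here, a^2 cancels. *)
have := dot_ge0 (vsub (fun i => dot u u * v i) (fun i => dot u v * u i)).
rewrite dotBr !dotBl !dotZl !dotZr (dotC v u) -!norm_sqr.
set a := norm u in u0 pu *; set b := norm v in pv *; set d := dot u v => H.
have {}H : 0 <= (a * a) * ((a * b) * (a * b) - d * d) by nra.
have : 0 <= (a * b) * (a * b) - d * d.
  have aa : 0 < a * a by nra.
  by apply: Rnot_lt_le => K; nra.
have ab : 0 <= a * b by nra.
by move=> K; nra.
Qed.

Lemma norm_le_sqr u (c : R) : 0 <= c -> dot u u <= c * c -> norm u <= c.
Proof. by move=> c0 H; rewrite -(sqrt_square c) //; apply: sqrt_le_1_alt. Qed.

Lemma norm_triang u v : norm (fun i => u i + v i) <= norm u + norm v.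
Proof.
have pu := norm_ge0 u; have pv := norm_ge0 v.
apply: norm_le_sqr; first by lra.
rewrite dotDr !dotDl (dotC v u) -!norm_sqr.
by have := cauchy_schwarz u v; nra.
Qed.

Lemma norm_sub_triang u v w : norm (vsub u w) <= norm (vsub u v) + norm (vsub v w).
Proof.
apply: Rle_trans (norm_triang _ _).
by rewrite (@eq_norm _ (vsub u w)) => [|i]; rewrite /vsub; lra.
Qed.

Lemma norm_le_sum u : norm u <= \big[Rplus/0]_i Rabs (u i).
Proof.
have s0 : 0 <= \big[Rplus/0]_i Rabs (u i) by apply: sumR_ge0 => i _; exact: Rabs_pos.
apply: norm_le_sqr => //.
rewrite [X in _ <= X]big_distrr /=; apply: sumR_le => i _.
have -> : u i * u i = Rabs (u i) * Rabs (u i) by split_Rabs; ring.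
apply: Rmult_le_compat_r; first exact: Rabs_pos.
by apply: (@sumR_term _ xpredT (fun i => Rabs (u i))) => // j _; exact: Rabs_pos.
Qed.

Lemma norm_sum (J : finType) (V : J -> I -> R) :
  norm (fun i => \big[Rplus/0]_j V j i) <= \big[Rplus/0]_j norm (V j).
Proof.
have -> : \big[Rplus/0]_j norm (V j) = \big[Rplus/0]_(j <- enum J) norm (V j).
  by rewrite big_enum.
rewrite (@eq_norm _ (fun i => \big[Rplus/0]_(j <- enum J) V j i)); last first.
  by move=> i; rewrite big_enum.
elim: (enum J) => [|j s IH].
  rewrite big_nil (_ : norm _ = 0); first by lra.
  by apply/norm0P => i; rewrite big_nil.
rewrite big_cons; apply: Rle_trans; last by apply: Rplus_le_compat_l; exact: IH.
apply: Rle_trans (norm_triang _ _).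
by rewrite (@eq_norm _ (fun i => V j i + \big[Rplus/0]_(j0 <- s) V j0 i)) => [|i];
  rewrite ?big_cons; lra.
Qed.

(** At [u = 0] both sides vanish whatever value [/ 0] has, so coincident agents need no separate
    treatment in the coupling terms. *)
Lemma norm_unit u : dot u (fun i => u i / norm u) = norm u.
Proof.
rewrite (@eq_dot _ u _ (fun i => / norm u * u i)) //; last by move=> i; rewrite /Rdiv; ring.
rewrite dotZr -norm_sqr.
have [->|u0] := Req_dec (norm u) 0; first by ring.
by field.
Qed.

Lemma norm_unit_le u : norm (fun i => u i / norm u) <= 1.
Proof.
rewrite (@eq_norm _ (fun i => / norm u * u i)); last by move=> i; rewrite /Rdiv; ring.
rewrite normZ.
have := norm_ge0 u; have [->|u0] := Req_dec (norm u) 0; first by lra.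
move=> p; rewrite Rabs_pos_eq; last by apply/Rlt_le/Rinv_0_lt_compat; lra.
by rewrite Rinv_l //; lra.
Qed.

End Norm.

(** * Absolutely continuous functions *)

(** Continuous induction from right to left: near every [t], [P] passes from points at or right of
    [t] to points at or left of it. The infimum of the points satisfying [P] therefore satisfies it
    too, and can be passed unless it is [a]. *)
Lemma real_induction (P : R -> Prop) a b : a <= b -> P b ->
  (forall t, a <= t <= b -> exists2 r, 0 < r &
     forall u w, a <= u <= t -> t <= w <= b -> t - r < u -> w < t + r -> P w -> P u) ->
  P a.
Proof.
move=> ab Pb loc.
(* Completeness speaks of suprema, hence the sign: [- s] will be the infimum. *)
pose E s := exists t, [/\ s = - t, a <= t <= b & P t].
have [s [ub lub]] : {s | is_lub E s}.
  apply: completeness; first by exists (- a) => _ [t [-> ? _]]; lra.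
  by exists (- b), b; split=> //; lra.
have sb : - b <= s by apply: ub; exists b; split=> //; lra.
have sa : s <= - a by apply: lub => _ [t [-> ? _]]; lra.
have [r r0 Hr] := loc (- s) ltac:(lra).
have [w [wb Ew Pw]] : exists w, [/\ w < - s + r, - s <= w <= b & P w].
  apply: NNPP => no.
  suff : s <= s - r by lra.
  apply: lub => _ [t [-> tab Pt]]; apply: Rnot_lt_le => K; apply: no.
  exists t; split=> //; first by lra.
  by split; [have := ub (- t) (ex_intro _ t (And3 erefl tab Pt)); lra | lra].
have step u : a <= u <= - s -> - s - r < u -> P u by move=> H1 H2; exact: (Hr u w).
have [->|sNa] := Req_dec a (- s); first by apply: step; lra.
pose u := Rmax a (- s - r / 2).
have [ua us] : a <= u /\ u < - s.
  by split; [exact: Rmax_l | apply: Rmax_lub_lt; lra].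
have ur : - s - r < u by have := Rmax_r a (- s - r / 2); rewrite -/u; lra.
suff : - u <= s by lra.
by apply: ub; exists u; split=> //; [lra | apply: step; lra].
Qed.

Lemma intervals_in_le a a' b b' l : a' <= a -> b <= b' ->
  intervals_in a b l -> intervals_in a' b' l.
Proof.
elim: l a a' => [|[c d] l IH] a a' //= aa bb [? [? [? H]]].
do 3 (split; first by lra).
by apply: (IH d d) => //; lra.
Qed.

Lemma abs_cont_restrict g a b a' b' : a' <= a -> b <= b' ->
  abs_cont_on g a' b' -> abs_cont_on g a b.
Proof.
move=> aa bb ac eps eps0; have [d [d0 H]] := ac eps eps0.
by exists d; split=> // l /(intervals_in_le aa bb); exact: H.
Qed.

Lemma abs_cont_dom (J : finType) (z : J -> R -> R) h (L : R) a b :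
  (forall j, abs_cont_on (z j) a b) ->
  (forall s t, a <= s <= b -> a <= t <= b ->
     Rabs (h t - h s) <= L * \big[Rplus/0]_j Rabs (z j t - z j s)) ->
  abs_cont_on h a b.
Proof.
move=> ac dom eps eps0.
(* Adding 1 to each factor keeps the denominator positive when [L] is 0 or [J] is empty. *)
pose e := eps / ((Rabs L + 1) * (INR #|J| + 1)).
have L0 := Rabs_pos L; have J0 := pos_INR #|J|.
have e0 : 0 < e by apply: Rdiv_lt_0_compat => //; nra.
pose Q j d := forall l, intervals_in a b l -> total_len l < d -> total_var (z j) l < e.
have [d d0 Hd] : exists2 d, 0 < d & forall j, Q j d.
  apply: fin_min => [j|j d d' H ? l lab ll].
    by have [d [d0 H]] := ac j e e0; exists d.
  by apply: H => //; lra.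
exists d; split=> // l lab ll.
have H : total_var h l <= Rabs L * \big[Rplus/0]_j total_var (z j) l.
  elim: l a lab dom {ll ac Q Hd} => [|[s t] l IH] a' /=.
    by move=> _ _; rewrite big1 //; lra.
  case=> ? [? [? lab]] dom; rewrite /total_var /= big_split /= Rmult_plus_distr_l.
  apply: Rplus_le_compat.
    apply: Rle_trans (dom s t _ _) _; try lra.
    apply: Rmult_le_compat_r (Rle_abs _).
    by apply: sumR_ge0 => j _; exact: Rabs_pos.
  by apply: (IH t) => // s' t' ? ?; apply: dom; lra.
have H2 : \big[Rplus/0]_j total_var (z j) l <= INR #|J| * e.
  by rewrite -sumR_const; apply: sumR_le => j _; apply/Rlt_le/(Hd j l).
have eE : (Rabs L + 1) * (INR #|J| + 1) * e = eps by rewrite /e; field; nra.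
apply: Rle_lt_trans H _; rewrite -eE.
by have := Rmult_le_compat_l _ _ _ L0 H2; nra.
Qed.

Lemma abs_cont_lip g h (L : R) a b :
  abs_cont_on g a b ->
  (forall s t, a <= s <= b -> a <= t <= b -> Rabs (h t - h s) <= L * Rabs (g t - g s)) ->
  abs_cont_on h a b.
Proof.
move=> ac H; apply: (@abs_cont_dom unit (fun=> g) h L) => // s t sab tab.
by rewrite sumR_const card_unit /=; have := H s t sab tab; lra.
Qed.

Lemma abs_cont_sum (J : finType) (z : J -> R -> R) a b :
  (forall j, abs_cont_on (z j) a b) ->
  abs_cont_on (fun t => \big[Rplus/0]_j z j t) a b.
Proof.
move=> ac; apply: (abs_cont_dom ac (L := 1)) => s t _ _.
by rewrite -sumR_sub Rmult_1_l; exact: sumR_abs.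
Qed.

Lemma abs_cont_minus g h a b : abs_cont_on g a b -> abs_cont_on h a b ->
  abs_cont_on (fun t => g t - h t) a b.
Proof.
move=> ag ah; apply: (@abs_cont_dom bool (fun c => if c then g else h) _ 1).
  by case.
move=> s t _ _; rewrite (bigD1 true) //= (bigD1 false) //= big1; last by case.
by split_Rabs; lra.
Qed.

Lemma abs_cont_bounded g a b : a <= b -> abs_cont_on g a b ->
  exists B, forall t, a <= t <= b -> Rabs (g t) <= B.
Proof.
move=> ab ac; have [d [d0 H]] := ac 1 Rlt_0_1.
have close u w : a <= u -> u <= w -> w <= b -> w - u < d -> Rabs (g w - g u) < 1.
  move=> au uw wb wud; have := H [:: (u, w)].
  rewrite /total_len /total_var /= => K.
  by rewrite -[X in X < _]Rplus_0_r; apply: K => //; lra.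
apply: (@real_induction (fun s => exists B, forall t, s <= t <= b -> Rabs (g t) <= B) a b) => //.
  by exists (Rabs (g b)) => t tb; rewrite (_ : t = b); lra.
(* Two points within [d / 2] of [t] are less than [d] apart, so [g] changes by less than 1 between
   them. *)
move=> t tab; exists (d / 2); first by lra.
move=> u w ut wt ru rw [B HB]; exists (Rmax B (Rabs (g w) + 1)) => s sub.
have [sw|ws] := Rle_lt_dec s w.
  apply: Rle_trans (Rmax_r _ _).
  by have := @close s w; split_Rabs; lra.
by apply: Rle_trans (Rmax_l _ _); apply: HB; lra.
Qed.

Lemma abs_cont_sqr g a b : a <= b -> abs_cont_on g a b ->
  abs_cont_on (fun t => g t * g t) a b.
Proof.
move=> ab ac; have [B HB] := abs_cont_bounded ab ac.
apply: (abs_cont_lip ac (L := 2 * B)) => s t sab tab.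
have -> : g t * g t - g s * g s = (g t + g s) * (g t - g s) by ring.
rewrite Rabs_mult; apply: Rmult_le_compat_r; first exact: Rabs_pos.
by have := HB s sab; have := HB t tab; split_Rabs; lra.
Qed.

(** * Null sets of the line and derivative bounds almost everywhere *)

Lemma sum_f_R0_ge0 (F : nat -> R) K : (forall k, 0 <= F k) -> 0 <= sum_f_R0 F K.
Proof. by move=> F0; exact: cond_pos_sum. Qed.

Lemma sum_f_R0_mono (F : nat -> R) K K' : (forall k, 0 <= F k) -> (K <= K')%N ->
  sum_f_R0 F K <= sum_f_R0 F K'.
Proof.
move=> F0 /subnK <-; elim: (K' - K)%N => [|p IH]; first by rewrite add0n; lra.
by rewrite addSn /=; have := F0 (p + K).+1; lra.
Qed.

Lemma sum_f_R0_term (F : nat -> R) k : (forall k, 0 <= F k) -> F k <= sum_f_R0 F k.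
Proof.
by case: k => [|k] F0 /=; [lra | have := @sum_f_R0_ge0 F k F0; lra].
Qed.

(** The [k]-th interval of a cover of length at most [eps / 4] is widened by [eps / 8 * (1 / 2) ^ k]
    on each side, which adds less than [eps / 2] in all. Openness leaves around each point the room
    that [real_induction] asks for. *)
Lemma null_open_cover N eps : 0 < eps -> null_set_R N ->
  exists a b : nat -> R,
    [/\ forall k, a k <= b k,
        forall t, N t -> exists k, a k < t < b k &
        forall K, sum_f_R0 (fun k => b k - a k) K < eps].
Proof.
move=> e0 N0; have [a [b [ab [cov len]]]] := N0 (eps / 4) ltac:(lra).
pose r k := eps / 8 * (1 / 2) ^ k.
have r0 k : 0 < r k by apply: Rmult_lt_0_compat; [lra | apply: pow_lt; lra].
exists (fun k => a k - r k), (fun k => b k + r k); split=> [k|t /cov[k] ?|K].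
- by have := ab k; have := r0 k; lra.
- by exists k; have := r0 k; lra.
have -> : sum_f_R0 (fun k => b k + r k - (a k - r k)) K =
    sum_f_R0 (fun k => b k - a k) K + sum_f_R0 (fun k => 2 * r k) K.
  by rewrite -sum_plus; apply: PartSum.sum_eq => k _; ring.
have -> : sum_f_R0 (fun k => 2 * r k) K = eps / 4 * sum_f_R0 (fun k => (1/2) ^ k) K.
  by rewrite scal_sum; apply: PartSum.sum_eq => k _; rewrite /r; field.
rewrite tech3; last by lra.
have p0 : 0 < (1 / 2) ^ K.+1 by apply: pow_lt; lra.
have -> : (1 - (1 / 2) ^ K.+1) / (1 - 1 / 2) = 2 * (1 - (1 / 2) ^ K.+1) by field.
by have := len K; nra.
Qed.

Definition clamp (a b t : R) := Rmax a (Rmin t b).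

Lemma clamp_mono a b s t : s <= t -> clamp a b s <= clamp a b t.
Proof. by move=> st; apply: Rle_max_compat_l; exact: Rle_min_compat_r. Qed.

Lemma clamp_id a b t : a <= t <= b -> clamp a b t = t.
Proof. by move=> tab; rewrite /clamp Rmin_left ?Rmax_right; lra. Qed.

Lemma clamp_diff a b s t : a <= b -> clamp a b t - clamp a b s <= b - a.
Proof.
move=> ab; rewrite /clamp; have := Rmax_l a (Rmin s b).
have : Rmax a (Rmin t b) <= b by apply: Rmax_lub => //; exact: Rmin_r.
by lra.
Qed.

(* The clamps turn the exceptional intervals, each inside some member of the
   cover, into increments of a monotone function: this bounds their total
   length without any covering combinatorics. *)
Lemma abs_cont_incr_le g a b c N : a <= b -> abs_cont_on g a b -> null_set_R N ->
  (forall t, a <= t <= b -> ~ N t -> exists l, derivable_pt_lim g t l /\ l <= c) ->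
  g b - g a <= c * (b - a).
Proof.
move=> ab ac N0 der; apply: le_epsilon => e e0.
pose e1 := e / ((b - a) + 1 + Rabs c).
have c0 := Rabs_pos c.
have e10 : 0 < e1 by apply: Rdiv_lt_0_compat; lra.
have e1E : e1 * ((b - a) + 1 + Rabs c) = e by rewrite /e1; field; lra.
have [d [d0 Hd]] := ac e1 e10.
have [A [B [AB cov len]]] := null_open_cover (Rmin_glb_lt _ _ _ d0 e10) N0.
(* For [s <= b], [phi K s] adds up the lengths of the parts of the first [K + 1] cover intervals
   that lie in [[s, b]]. [P s] says that, outside a list of intervals whose length [phi] pays for,
   [g] grows on [[s, b]] at rate at most [c + e1]. *)
pose phi K s := sum_f_R0 (fun k => clamp (A k) (B k) b - clamp (A k) (B k) s) K.
pose P s := s <= b -> exists l, exists K,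
  [/\ intervals_in s b l, forall K', (K <= K')%N -> total_len l <= phi K' s &
    g b - g s <= (c + e1) * (b - s) + total_var g l + Rabs c * total_len l].
suff /(_ ab)[l [K [lab lK gb]]] : P a.
  have : total_len l < Rmin d e1.
    apply: Rle_lt_trans (lK K (leqnn _)) _; apply: Rle_lt_trans (len K).
    by apply: sum_Rle => k _; exact: clamp_diff.
  have := Rmin_l d e1; have := Rmin_r d e1 => m1 m2 ll.
  have tv : total_var g l < e1 by apply: Hd => //; lra.
  have : Rabs c * total_len l <= Rabs c * e1 by apply: Rmult_le_compat_l; lra.
  by nra.
apply: (real_induction ab).
  move=> _; exists [::], 0%N; split=> //.
    move=> K' _; apply: sum_f_R0_ge0 => k; rewrite /=; lra.
  by rewrite /total_len /total_var /=; lra.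
(* A point of [N] lies inside a cover interval, and so does [[u, w]]: it joins the list, and the
   [k]-th clamp pays for its length. *)
move=> t tab; have [Nt|Nt] := classic (N t).
  have [k kt] := cov t Nt.
  exists (Rmin (t - A k) (B k - t)); first by apply: Rmin_glb_lt; lra.
  have := Rmin_l (t - A k) (B k - t); have := Rmin_r (t - A k) (B k - t).
  move=> m1 m2 u w ut wt ru rw Pw _; have [l [K [lwb lK gw]]] := Pw ltac:(lra).
  exists ((u, w) :: l), (maxn K k); split.
  - by do 3 (split; first by lra).
  - move=> K'; rewrite geq_max => /andP[KK kK]; rewrite /total_len /= -/(total_len l).
    have -> : phi K' u = phi K' w +
        sum_f_R0 (fun k => clamp (A k) (B k) w - clamp (A k) (B k) u) K'.
      by rewrite /phi -sum_plus; apply: PartSum.sum_eq => i _; ring.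
    have F0 i : 0 <= clamp (A i) (B i) w - clamp (A i) (B i) u.
      by have := @clamp_mono (A i) (B i) u w ltac:(lra); lra.
    have := lK K' KK; have := sum_f_R0_mono F0 kK; have := sum_f_R0_term k F0.
    by rewrite !clamp_id /=; lra.
  - rewrite /total_len /total_var /= -/(total_len l) -/(total_var g l).
    have := Rle_abs (g w - g u); have : - Rabs c <= c by split_Rabs; lra.
    by nra.
(* Off [N] the list is kept. The derivative at [t] bounds the growth over [[u, t]] and over [[t, w]]
   separately. *)
have [l [dl lc]] := der t tab Nt.
have [r Hr] := dl e1 e10; exists r; first exact: cond_pos.
move=> u w ut wt ru rw Pw _; have [L [K [lwb lK gw]]] := Pw ltac:(lra).
have incr h : h <> 0 -> Rabs h < r -> Rabs (g (t + h) - g t - l * h) <= e1 * Rabs h.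
  move=> h0 /(Hr h h0) K1.
  have -> : g (t + h) - g t - l * h = ((g (t + h) - g t) / h - l) * h by field.
  by rewrite Rabs_mult; apply: Rmult_le_compat_r; [exact: Rabs_pos | lra].
have gwt : g w - g t <= (c + e1) * (w - t).
  have [->|wt'] := Req_dec w t; first by lra.
  have := incr (w - t); rewrite (_ : t + (w - t) = w); last by lra.
  rewrite [Rabs (w - t)]Rabs_pos_eq => [K1|]; last by lra.
  have := K1 ltac:(lra) ltac:(lra) => K2; have := Rle_abs (g w - g t - l * (w - t)).
  by nra.
have gtu : g t - g u <= (c + e1) * (t - u).
  have [->|wt'] := Req_dec u t; first by lra.
  have := incr (u - t); rewrite (_ : t + (u - t) = u); last by lra.
  rewrite [Rabs (u - t)]Rabs_left1 => [K1|]; last by lra.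
  have := K1 ltac:(lra) ltac:(lra) => K2; have := Rle_abs (- (g u - g t - l * (u - t))).
  by rewrite Rabs_Ropp; nra.
exists L, K; split.
- by apply: intervals_in_le lwb; lra.
- move=> K' KK; apply: Rle_trans (lK K' KK) _; apply: sum_Rle => i _.
  by have := @clamp_mono (A i) (B i) u w ltac:(lra); lra.
- by lra.
Qed.

Lemma abs_cont_incr_ge g a b c N : a <= b -> abs_cont_on g a b -> null_set_R N ->
  (forall t, a <= t <= b -> ~ N t -> exists l, derivable_pt_lim g t l /\ c <= l) ->
  c * (b - a) <= g b - g a.
Proof.
move=> ab ac N0 der.
have := @abs_cont_incr_le (fun t => - g t) a b (- c) N ab _ N0; case; try lra.
- by apply: (abs_cont_lip ac (L := 1)) => s t _ _; split_Rabs; lra.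
- move=> t tab /(der t tab)[l [dl lc]]; exists (- l); split; last by lra.
  exact: derivable_pt_lim_opp.
Qed.

(** * Compactness and convex functions *)

Definition cont_at {I : finType} (F : (I -> R) -> R) (z : I -> R) : Prop :=
  forall eps, 0 < eps -> exists2 delta, 0 < delta &
    forall y, norm (vsub y z) < delta -> Rabs (F y - F z) < eps.

Section Continuity.
Variable I : finType.
Implicit Types (F H : (I -> R) -> R) (z : I -> R).

Lemma cont_at_const c z : cont_at (fun=> c) z.
Proof. by move=> e e0; exists 1; [lra | move=> y _; rewrite Rminus_diag Rabs_R0]. Qed.

Lemma cont_at_coord i z : cont_at (fun y => y i) z.
Proof.
move=> e e0; exists e => // y; apply: Rle_lt_trans.
exact: (norm_coord (vsub y z) i).
Qed.

Lemma cont_at_comp F (h : R -> R) z : cont_at F z -> continuity_pt h (F z) ->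
  cont_at (fun y => h (F y)) z.
Proof.
move=> cF ch e e0; have [d [d0 Hd]] := ch e e0; have [r r0 Hr] := cF d d0.
exists r => // y /Hr yr; have [->|ne] := Req_dec (F y) (F z).
  by rewrite Rminus_diag Rabs_R0.
by apply: (Hd (F y)); split=> //; split=> // K; apply: ne.
Qed.

Lemma cont_at_add F H z : cont_at F z -> cont_at H z -> cont_at (fun y => F y + H y) z.
Proof.
move=> cF cH e e0; have [d d0 Hd] := cF (e / 2) ltac:(lra).
have [r r0 Hr] := cH (e / 2) ltac:(lra).
exists (Rmin d r); first exact: Rmin_glb_lt.
move=> y yz; have := Hd y (Rlt_le_trans _ _ _ yz (Rmin_l _ _)).
have := Hr y (Rlt_le_trans _ _ _ yz (Rmin_r _ _)).
by split_Rabs; lra.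
Qed.

Lemma cont_at_scal (c : R) F z : cont_at F z -> cont_at (fun y => c * F y) z.
Proof.
move=> cF; apply: (cont_at_comp (h := fun r => c * r)) => //.
by apply: derivable_continuous_pt; reg.
Qed.

Lemma cont_at_sub F H z : cont_at F z -> cont_at H z -> cont_at (fun y => F y - H y) z.
Proof.
move=> cF /(cont_at_scal (-1)) cH e e0.
have [d d0 Hd] := cont_at_add cF cH e0.
by exists d => // y /Hd; split_Rabs; lra.
Qed.

Lemma cont_at_sqr F z : cont_at F z -> cont_at (fun y => F y * F y) z.
Proof.
move=> cF; apply: (cont_at_comp (h := fun r => r * r)) => //.
by apply: derivable_continuous_pt; reg.
Qed.

Lemma cont_at_sum (J : finType) (P : pred J) (F : J -> (I -> R) -> R) z :
  (forall j, P j -> cont_at (F j) z) ->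
  cont_at (fun y => \big[Rplus/0]_(j | P j) F j y) z.
Proof.
move=> cF.
have -> : (fun y => \big[Rplus/0]_(j | P j) F j y) =
          (fun y => \big[Rplus/0]_(j <- enum P) F j y).
  by apply: functional_extensionality => y; rewrite big_enum.
have {cF} : forall j, j \in enum P -> cont_at (F j) z.
  by move=> j; rewrite mem_enum; exact: cF.
elim: (enum P) => [|j s IH] cF.
  have -> : (fun y => \big[Rplus/0]_(j <- [::]) F j y) = fun=> 0.
    by apply: functional_extensionality => y; rewrite big_nil.
  exact: cont_at_const.
have -> : (fun y => \big[Rplus/0]_(j <- j :: s) F j y) =
          (fun y => F j y + \big[Rplus/0]_(j <- s) F j y).
  by apply: functional_extensionality => y; rewrite big_cons.
apply: cont_at_add; first by apply: cF; rewrite inE eqxx.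
by apply: IH => i si; apply: cF; rewrite inE si orbT.
Qed.

Lemma cont_at_norm (J : finType) (p : (I -> R) -> J -> R) z :
  (forall j, cont_at (fun y => p y j) z) -> cont_at (fun y => norm (p y)) z.
Proof.
move=> cp; apply: cont_at_comp; last exact/continuity_pt_sqrt/dot_ge0.
by apply: cont_at_sum => j _; exact: cont_at_sqr.
Qed.

Lemma cont_at_map (J K : finType) (p : (I -> R) -> J -> R)
    (H : (J -> R) -> K -> R) k z :
  continuous_map H -> (forall j, cont_at (fun y => p y j) z) ->
  cont_at (fun y => H (p y) k) z.
Proof.
move=> cH cp e e0; have [d [d0 Hd]] := cH (p z) e e0.
have [r r0 Hr] : exists2 r, 0 < r & forall y, norm (vsub y z) < r -> norm (vsub (p y) (p z)) < d.
  have : cont_at (fun y => norm (vsub (p y) (p z))) z.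
    by apply: cont_at_norm => j; apply: cont_at_sub (cp j) _; exact: cont_at_const.
  move=> /(_ d d0)[r r0 Hr]; exists r => // y /Hr.
  have -> : norm (vsub (p z) (p z)) = 0 by apply/norm0P => j; rewrite /vsub; ring.
  by split_Rabs; lra.
exists r => // y /Hr/Hd; apply: Rle_lt_trans.
exact: (norm_coord (vsub (H (p y)) (H (p z))) k).
Qed.

End Continuity.

(** * Sequential compactness in finite dimension *)

Definition converges {I : finType} (u : nat -> I -> R) (l : I -> R) : Prop :=
  forall e, 0 < e -> exists P, forall p, (P <= p)%N -> norm (vsub (u p) l) < e.

Lemma INR_large (B : R) : exists P, forall p, (P <= p)%N -> B < INR p.
Proof.
have [P HP] := INR_unbounded B; exists P => p /leP/le_INR; lra.
Qed.

(** Around a cluster point [l], an index [k >= p] with [v k] within [1 / (p + 1)] of [l] is chosen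
    for each [p]. The choice [phi] may fail to be increasing; [p <= phi p] suffices for tails and is
    stable under composition. *)
Lemma bounded_subseq_R (v : nat -> R) B : (forall p, Rabs (v p) <= B) ->
  exists phi : nat -> nat, exists l, (forall p, (p <= phi p)%N) /\
    Un_cv (fun p => v (phi p)) l.
Proof.
move=> vB.
have [l Hl] := Bolzano_Weierstrass v _ (compact_P3 (- B) B)
  (fun p => ltac:(have := vB p; split_Rabs; lra)).
have ex p : exists k, (p <= k)%N /\ Rabs (v k - l) < / (INR p + 1).
  have p0 : 0 < / (INR p + 1) by apply: Rinv_0_lt_compat; have := pos_INR p; lra.
  have [|k [pk vk]] := Hl (disc l (mkposreal _ p0)) p.
    by exists (mkposreal _ p0).
  by exists k; split=> //; exact/leP.
have [phi Hphi] := choice _ ex.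
exists phi, l; split=> [p|e e0]; first by case: (Hphi p).
have [N HN] := archimed_cor1 e e0; exists N => p /le_INR Np.
apply: Rlt_trans (proj2 (Hphi p)) _; case: HN => HN N0.
apply: Rle_lt_trans HN; apply: Rinv_le_contravar; last by lra.
exact: lt_0_INR.
Qed.

Lemma bounded_subseq (I : finType) (u : nat -> I -> R) B :
  (forall p, norm (u p) <= B) ->
  exists phi : nat -> nat, exists l, (forall p, (p <= phi p)%N) /\
    converges (fun p => u (phi p)) l.
Proof.
move=> uB.
suff [phi [l [Hphi Hl]]] : exists phi : nat -> nat, exists l : I -> R,
    (forall p, (p <= phi p)%N) /\
    forall i, i \in enum I -> Un_cv (fun p => u (phi p) i) (l i).
  exists phi, l; split=> // e e0.
  pose e1 := e / (INR #|I| + 1); have I0 := pos_INR #|I|.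
  have e10 : 0 < e1 by apply: Rdiv_lt_0_compat; lra.
  have e1E : e1 * (INR #|I| + 1) = e by rewrite /e1; field; lra.
  have [P HP] : exists P : R, forall i p, P <= INR p -> Rabs (u (phi p) i - l i) < e1.
    apply: (@fin_max I (fun i P => forall p, P <= INR p -> Rabs (u (phi p) i - l i) < e1)).
      move=> i; have [N HN] := Hl i ltac:(by rewrite mem_enum) e1 e10.
      by exists (INR N) => p /INR_le; exact: HN.
    by move=> i d d' H dd p pd; apply: H; lra.
  have [Q HQ] := INR_large P; exists Q => p /HQ/Rlt_le Pp.
  apply: Rle_lt_trans (norm_le_sum _) _.
  apply: (@Rle_lt_trans _ (INR #|I| * e1)); last by lra.
  rewrite -sumR_const; apply: sumR_le => i _; exact/Rlt_le/HP.
elim: (enum I) => [|i s [phi [l [Hphi Hl]]]].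
  by exists id, (fun=> 0).
(* Refining by [psi] makes coordinate [i] converge and preserves the limits of the coordinates
   already treated. *)
have [psi [r [Hpsi Hr]]] := @bounded_subseq_R (fun p => u (phi p) i) B
  (fun p => Rle_trans _ _ _ (norm_coord _ _) (uB _)).
exists (phi \o psi), (fun j => if j == i then r else l j); split.
  by move=> p; apply: leq_trans (Hpsi p) (Hphi _).
move=> j; rewrite inE; have [->|_] /= := eqVneq j i; first by [].
move=> /Hl lj e /lj[N HN]; exists N => p /leP Np; apply: HN; apply/leP.
exact: leq_trans Np (Hpsi p).
Qed.

Lemma converges_cont (I : finType) (F : (I -> R) -> R) u l :
  cont_at F l -> converges u l ->
  forall e, 0 < e -> exists P, forall p, (P <= p)%N -> Rabs (F (u p) - F l) < e.
Proof.
move=> cF ul e /cF[d /ul[P HP] Hd]; exists P => p /HP; exact: Hd.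
Qed.

Lemma cont_bounded (I : finType) (F : (I -> R) -> R) B :
  (forall u, cont_at F u) -> exists M, forall u, norm u <= B -> F u <= M.
Proof.
move=> cF; apply: NNPP => no.
have ex p : exists u, norm u <= B /\ INR p < F u.
  apply: NNPP => no2; apply: no; exists (INR p) => u uB.
  by apply: Rnot_lt_le => K; apply: no2; exists u.
have [u Hu] := choice _ ex.
have [phi [l [Hphi Hl]]] := bounded_subseq (fun p => proj1 (Hu p)).
have [P HP] := converges_cont (cF l) Hl Rlt_0_1.
have [Q HQ] := INR_large (F l + 1).
have := HP (maxn P Q) (leq_maxl _ _).
have := HQ (phi (maxn P Q)) (leq_trans (leq_maxr P Q) (Hphi _)).
have := proj2 (Hu (phi (maxn P Q))).
by split_Rabs; lra.
Qed.

(** The minimizer is the limit of a minimizing sequence. The constraint [H <= 0] serves both for a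
    sphere, with [H] the distance of the radius to its target, and for a ball, with [H] zero. *)
Lemma attains_min (I : finType) (F H : (I -> R) -> R) B :
  (forall u, cont_at F u) -> (forall u, cont_at H u) ->
  (exists u, norm u <= B /\ H u <= 0) ->
  exists s, H s <= 0 /\ forall u, norm u <= B -> H u <= 0 -> F s <= F u.
Proof.
move=> cF cH [u0 [u0B Hu0]].
pose E r := exists u, [/\ norm u <= B, H u <= 0 & r = - F u].
have [M HM] := @cont_bounded I (fun u => -1 * F u) B (fun u => cont_at_scal (-1) (cF u)).
have [r [ub lub]] : {r | is_lub E r}.
  apply: completeness; first by exists M => _ [u [/HM uM _ ->]]; lra.
  by exists (- F u0), u0.
have ex p : exists u, [/\ norm u <= B, H u <= 0 & r - / (INR p + 1) < - F u].
  apply: NNPP => no.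
  suff : r <= r - / (INR p + 1).
    by have := Rinv_0_lt_compat (INR p + 1); have := pos_INR p; lra.
  apply: lub => _ [u [uB Hu ->]]; apply: Rnot_lt_le => K.
  by apply: no; exists u.
have [u Hu] := choice _ ex.
have uB p : norm (u p) <= B by case: (Hu p).
have [phi [l [Hphi Hl]]] := bounded_subseq uB.
exists l; split.
  apply: le_epsilon => e e0; have [P HP] := converges_cont (cH l) Hl e0.
  have := HP P (leqnn _); case: (Hu (phi P)) => _ + _.
  by split_Rabs; lra.
move=> w wB Hw; apply: le_epsilon => e e0.
have : - F w <= r by apply: ub; exists w.
have [P HP] := converges_cont (cF l) Hl (e := e / 2) ltac:(lra).
have [Q HQ] := INR_large (2 / e).
set p := maxn P Q.
have := HP p (leq_maxl _ _); have := HQ _ (leq_trans (leq_maxr P Q) (Hphi p)).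
case: (Hu (phi p)) => _ _ H1 H2.
have i0 : 0 < 2 / e by apply: Rdiv_lt_0_compat; lra.
have : / (INR (phi p) + 1) < e / 2.
  have -> : e / 2 = / (2 / e) by field; lra.
  by apply: Rinv_lt_contravar; nra.
by split_Rabs; lra.
Qed.

(** * Gradients and convexity *)

Section Convex.
Variables (I : finType) (F : (I -> R) -> R) (DF : (I -> R) -> I -> R).
Hypothesis F_grad : has_gradient F DF.

(** The directional derivative along [d]. Dividing the tolerance and the radius by [norm d + 1]
    absorbs the length of [d] and admits [d = 0]. *)
Lemma gradient_dir u d e : 0 < e -> exists2 r, 0 < r & forall l, 0 < l < r ->
  Rabs (F (fun k => u k + l * d k) - F u - l * dot (DF u) d) <= e * l.
Proof.
move=> e0; have n0 := norm_ge0 d.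
have e10 : 0 < e / (norm d + 1) by apply: Rdiv_lt_0_compat; lra.
have [r [r0 Hr]] := F_grad u e10.
exists (r / (norm d + 1)); first by apply: Rdiv_lt_0_compat; lra.
move=> l [l0 lr].
have E : vsub (fun k => u k + l * d k) u =1 (fun k => l * d k).
  by move=> k; rewrite /vsub; ring.
have nE : norm (vsub (fun k => u k + l * d k) u) = l * norm d.
  by rewrite (eq_norm E) normZ Rabs_pos_eq //; lra.
have rE : r / (norm d + 1) * (norm d + 1) = r by field; lra.
have eE : e / (norm d + 1) * (norm d + 1) = e by field; lra.
have := Hr (fun k => u k + l * d k); rewrite nE (eq_dot (fun=> erefl) E) dotZr => K.
apply: Rle_trans (K _) _; first by nra.
by set a := e / _ in e10 eE *; nra.
Qed.

Lemma has_gradient_cont u : cont_at F u.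
Proof.
move=> e e0; have [r [r0 Hr]] := F_grad u Rlt_0_1.
have n0 := norm_ge0 (DF u).
exists (Rmin r (e / (norm (DF u) + 1))).
  by apply: Rmin_glb_lt => //; apply: Rdiv_lt_0_compat; lra.
move=> y yr; have := Hr y (Rlt_le_trans _ _ _ yr (Rmin_l _ _)).
have := Rlt_le_trans _ _ _ yr (Rmin_r _ _).
have := cauchy_schwarz (DF u) (vsub y u).
have := cauchy_schwarz (DF u) (vsub u y); rewrite norm_sym.
have -> : dot (DF u) (vsub u y) = - dot (DF u) (vsub y u) by rewrite !dotBr; ring.
set N := norm (vsub y u); set a := dot _ _; move=> K1 K2 Ny.
have : N * (norm (DF u) + 1) < e.
  rewrite -(_ : e / (norm (DF u) + 1) * (norm (DF u) + 1) = e); last by field; lra.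
  by apply: Rmult_lt_compat_r; lra.
by split_Rabs; lra.
Qed.

(** Moving from [u] along [- DF u] lowers [F] to first order at rate |DF u|^2, which a minimum
    forbids unless the gradient vanishes. *)
Lemma min_gradient0 u : (forall v, F u <= F v) -> forall i, DF u i = 0.
Proof.
move=> mu; apply/norm0P.
have n0 := norm_ge0 (DF u).
suff : dot (DF u) (DF u) <= 0 by rewrite -norm_sqr; nra.
apply: le_epsilon => e e0.
have [r r0 Hr] := @gradient_dir u (fun k => -1 * DF u k) e e0.
have := Hr (r / 2) ltac:(lra); have := mu (fun k => u k + r / 2 * (-1 * DF u k)).
rewrite dotZr; set a := F _; set b := F _ => ab.
by split_Rabs; nra.
Qed.

Hypothesis F_convex : convex_fun F.

(** Convexity bounds the difference quotient from [u] towards [v] by [F v - F u] for every step in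
    (0, 1]; the scalar product is its limit as the step tends to 0. *)
Lemma convex_gradient u v : F u + dot (DF u) (vsub v u) <= F v.
Proof.
suff : dot (DF u) (vsub v u) <= F v - F u by lra.
apply: le_epsilon => e e0; have [r r0 Hr] := @gradient_dir u (vsub v u) e e0.
pose l := Rmin 1 (r / 2).
have l1 : l <= 1 by exact: Rmin_l.
have lr : l <= r / 2 by exact: Rmin_r.
have l0 : 0 < l by apply: Rmin_glb_lt; lra.
have := Hr l ltac:(lra); have := @F_convex v u l ltac:(lra).
rewrite (_ : (fun k => l * v k + (1 - l) * u k) = (fun k => u k + l * vsub v u k)); last first.
  by apply: functional_extensionality => k; rewrite /vsub; ring.
set a := F _ => H1 H2.
suff : l * dot (DF u) (vsub v u) <= l * (F v - F u + e) by apply: Rmult_le_reg_l.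
by split_Rabs; lra.
Qed.

Lemma convex_gradient_le u v : F u - F v <= dot (vsub u v) (DF u).
Proof. by have := convex_gradient u v; rewrite dotBr dotBl !(dotC _ (DF u)); lra. Qed.

(** The first-order inequality at each end gives one of the two signs, so gradients inside the
    segment do not enter. *)
Lemma convex_lip M u v : norm (DF u) <= M -> norm (DF v) <= M ->
  Rabs (F u - F v) <= M * norm (vsub u v).
Proof.
move=> uM vM; have := convex_gradient u v; have := convex_gradient v u.
have := cauchy_schwarz (DF v) (vsub v u); have := cauchy_schwarz (DF u) (vsub u v).
rewrite (norm_sym v u) !dotBr; have := norm_ge0 (vsub u v).
move=> n0 H1 H2; have := Rmult_le_compat_r _ _ _ n0 uM; have := Rmult_le_compat_r _ _ _ n0 vM.
by split_Rabs; lra.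
Qed.

(* On a sphere around a minimizer that encloses the whole minimizer set, F
   exceeds its minimum by a fixed amount; convexity propagates this linearly. *)
Lemma convex_growth :
  (exists s, forall k, DF s k = 0) ->
  bounded_set (fun s => forall k, DF s k = 0) ->
  exists c, exists C, 0 < c /\ forall u, c * norm u - C <= F u.
Proof.
move=> [s s0] [M HM].
have smin u : F s <= F u.
  have := convex_gradient s u.
  by rewrite /dot big1 => [|i _]; [lra | rewrite s0; ring].
have ns0 := norm_ge0 s; have sM := HM s s0.
(* This radius puts the sphere around [s] outside the ball of radius [M], which contains all
   critical points. *)
pose r := M + norm s + 1.
have [mu mu0 Hmu] : exists2 mu, 0 < mu &
    forall u, norm (vsub u s) = r -> F s + mu <= F u.
  pose H u := Rabs (norm (vsub u s) - r).
  have cH u : cont_at H u.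
    apply: cont_at_comp; last exact: Rcontinuity_abs.
    apply: cont_at_sub; last exact: cont_at_const.
    apply: cont_at_norm => i; apply: cont_at_sub; last exact: cont_at_const.
    exact: cont_at_coord.
  have HB u : norm (vsub u s) = r -> norm u <= r + norm s.
    move=> ur; rewrite -ur; have := norm_triang (vsub u s) s.
    by rewrite (@eq_norm _ _ u) // => i; rewrite /vsub; ring.
  (* In dimension zero the sphere is empty and any positive [mu] serves. *)
  have [ne|ne] := classic (exists u, norm (vsub u s) = r); last first.
    by exists 1; [lra | move=> u ur; case: ne; exists u].
  have [w [Hw wmin]] : exists w, H w <= 0 /\
      forall u, norm u <= r + norm s -> H u <= 0 -> F w <= F u.
    apply: attains_min => //; first exact: has_gradient_cont.
    case: ne => u ur; exists u; split; first exact: HB.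
    by rewrite /H ur Rminus_diag Rabs_R0; lra.
  have wr : norm (vsub w s) = r by move: Hw; rewrite /H; split_Rabs; lra.
  exists (F w - F s).
    suff : F w <> F s by have := smin w; lra.
    (* Equality would make [w] a minimizer, hence a critical point of norm at most [M], while |w -
       s| = M + |s| + 1. *)
    move=> ws; have : norm w <= M by apply: HM; apply: min_gradient0 => v; rewrite ws.
    have := norm_triang w (fun i => -1 * s i); rewrite normZ Rabs_Ropp Rabs_R1.
    by rewrite (@eq_norm _ _ (vsub w s)) => [|i]; rewrite /vsub ?wr /r; lra.
  move=> u ur; have := wmin u (HB u ur); rewrite /H ur Rminus_diag Rabs_R0; lra.
have r0 : 0 < r by rewrite /r; lra.
have c0 : 0 < mu / r by exact: Rdiv_lt_0_compat.
have cr : mu / r * r = mu by field; lra.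
exists (mu / r), (mu / r * norm s + mu - F s); split=> // u.
suff H : F s - mu + mu / r * norm (vsub u s) <= F u.
  have : norm u <= norm (vsub u s) + norm s.
    by rewrite -{1}(@eq_norm _ (fun i => vsub u s i + s i) u) => [|i];
      [exact: norm_triang | rewrite /vsub; ring].
  by nra.
(* Inside the ball the linear term is at most [mu], so minimality of [s] suffices. Outside, the
   segment from [s] to [u] meets the sphere at weight [r / d]. *)
set d := norm (vsub u s); have [dr|rd] := Rle_lt_dec d r.
  by have := smin u; nra.
have lE : r / d * d = r by field; lra.
have l0 : 0 < r / d by apply: Rdiv_lt_0_compat; lra.
have l1 : r / d <= 1 by apply: Rnot_lt_le => K; nra.
have := @F_convex u s (r / d) ltac:(lra).
set p := (fun k => _) => Hp.
have /Hmu Hp2 : norm (vsub p s) = r.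
  rewrite (@eq_norm _ _ (fun k => r / d * vsub u s k)); last by move=> k; rewrite /vsub /p; ring.
  by rewrite normZ Rabs_pos_eq -/d; lra.
have : mu <= r / d * (F u - F s) by lra.
move=> K; have : mu * d <= r * (F u - F s) by rewrite -[X in _ <= X * _]lE; nra.
move=> K2; apply: (Rmult_le_reg_l r) => //.
by rewrite (_ : r * (F s - mu + mu / r * d) = r * F s - r * mu + mu * d); [nra | field; lra].
Qed.

End Convex.

(** * The Filippov set of the closed loop *)

Lemma sum_f_R0_le_const (F : nat -> R) (c : R) p K : 0 <= c ->
  (forall k, (k < p)%N -> F k <= c) -> (forall k, (p <= k)%N -> F k <= 0) ->
  sum_f_R0 F K <= INR p * c.
Proof.
move=> c0 Fc F0.
suff : sum_f_R0 F K <= INR (minn p K.+1) * c.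
  by have /leP/le_INR := geq_minl p K.+1; nra.
elim: K => [|K IH] /=.
  case: p Fc F0 => [|p] Fc F0; first by rewrite min0n /=; have := F0 0%N erefl; lra.
  by rewrite (_ : minn p.+1 1 = 1%N) /=; [have := Fc 0%N erefl; lra | exact/minn_idPr].
have [Kp|pK] := ltnP K.+1 p.
  move: IH; rewrite !(minn_idPr _) //; last exact: ltnW.
  by have := Fc _ Kp; rewrite (S_INR K.+1); lra.
rewrite (minn_idPl _); last exact: leq_trans pK _.
by move: IH; rewrite (minn_idPl pK); have := F0 _ pK; lra.
Qed.

Lemma prodR_le (I : finType) (P : pred I) (F : I -> R) (c : R) : 0 <= c ->
  (forall i, P i -> 0 <= F i <= c) ->
  0 <= \big[Rmult/1]_(i | P i) F i <= \big[Rmult/1]_(i | P i) c.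
Proof.
move=> c0 Fc; elim/big_ind2: _ => //; first by lra.
by move=> *; split; [apply: Rmult_le_pos | apply: Rmult_le_compat]; lra.
Qed.

(** The diagonal of the square spanned by [c1] and [c2] is covered by [p] squares of side
    [h = 2 / p]. Each other coordinate contributes a factor 2, collected in [D], so the total volume
    is [4 * D / p]. A bounded piece around [z] is enough, as the Filippov set looks only at nearby
    points. *)
Lemma null_diag (I : finType) (c1 c2 : I) (z : I -> R) : c1 != c2 ->
  null_set (fun y => y c1 = y c2 /\ forall c, Rabs (y c - z c) <= 1).
Proof.
move=> c12 eps e0.
pose D := \big[Rmult/1]_(i | (i != c1) && (i != c2)) 2.
have D0 : 0 <= D by have [] := @prodR_le I (fun i => (i != c1) && (i != c2)) (fun=> 2) 2
  ltac:(lra) (fun _ _ => ltac:(lra)).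
have [p Hp] := INR_unbounded (4 * D / eps + 1).
have p1 : 1 <= INR p.
  suff : 0 <= 4 * D / eps by lra.
  by apply: Rle_mult_inv_pos; lra.
pose h := 2 / INR p; have h0 : 0 < h by apply: Rdiv_lt_0_compat; lra.
have ph : INR p * h = 2 by rewrite /h; field; lra.
pose lo k := z c1 - 1 + INR k * h.
pose sp i := (i == c1) || (i == c2).
(* From index [p] on, the boxes are the single point 0, of volume zero because the coordinate [c1]
   exists. *)
exists (fun k i => if (k < p)%N then (if sp i then lo k else z i - 1) else 0).
exists (fun k i => if (k < p)%N then (if sp i then lo k + h else z i + 1) else 0).
split; [|split].
- by move=> k i; case: ifP => _; [case: ifP => _; lra | lra].
- move=> y [y12 yz].
  have yz1 : 0 <= y c1 - (z c1 - 1) <= 2 by have := yz c1; split_Rabs; lra.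
  have [k kp Hk] : exists2 k, (k < p)%N & lo k <= y c1 <= lo k + h.
    (* A slice containing [y c1] is sought among the indices up to [q], its upper bound being waived
       at [k = q]; at [q = p - 1] that bound follows from [p * h = 2]. *)
    have : forall q, exists k, (k <= q)%N /\ lo k <= y c1 /\ ((k < q)%N -> y c1 <= lo k + h).
      elim=> [|q [k [kq [Hk1 Hk2]]]]; first by exists 0%N; split=> //; rewrite /lo /=; split=> //; lra.
      have [Hq|Hq] := Rle_lt_dec (lo q.+1) (y c1).
        by exists q.+1; split=> //; split=> //; rewrite ltnn.
      exists k; split; first exact: leqW.
      split=> // kq1; move: kq; rewrite leq_eqVlt => /orP[/eqP E|/Hk2//].
      by move: Hq; rewrite -E /lo S_INR; lra.
    move=> /(_ p.-1)[k [kp [Hk1 Hk2]]].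
    have pp : (0 < p)%N by case: (p) p1 => //=; lra.
    exists k; first by rewrite -(prednK pp) ltnS.
    split=> //; move: kp; rewrite leq_eqVlt => /orP[/eqP E|/Hk2//].
    rewrite E /lo; have : INR p = INR p.-1 + 1 by rewrite -{1}(prednK pp) S_INR.
    by nra.
  exists k => i; rewrite kp /sp; have [->|_] /= := eqVneq i c1; first by [].
  have [->|_] /= := eqVneq i c2; first by rewrite -y12.
  by have := yz i; split_Rabs; lra.
- move=> K; apply: Rle_trans (@sum_f_R0_le_const _ (h * h * D) p K _ _ _) _.
  + by apply: Rmult_le_pos => //; nra.
  + move=> k kp; rewrite /box_vol kp (bigD1 c1) //= (bigD1 c2) //=; last by rewrite eq_sym.
    rewrite /sp !eqxx orbT /= (_ : lo k + h - lo k = h); last by lra.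
    rewrite -Rmult_assoc; apply: Rmult_le_compat_l; first by nra.
    rewrite /D; apply: Req_le; apply: eq_bigr => i /andP[/negbTE-> /negbTE->] /=; lra.
  + move=> k; rewrite leqNgt => /negbTE kp; rewrite /box_vol (bigD1 c1) //= kp.
    by rewrite Rminus_diag Rmult_0_l; lra.
  rewrite (_ : INR p * (h * h * D) = INR p * h * (h * D)); last by ring.
  rewrite ph.
  have : 4 * D / eps * eps = 4 * D by field; lra.
  move=> E; have : 4 * D <= eps * INR p by nra.
  move=> K1; apply: (Rmult_le_reg_r (INR p)); first by lra.
  by rewrite (_ : 2 * (h * D) * INR p = 2 * (INR p * h) * D); [rewrite ph; lra | ring].
Qed.

Lemma null_set_sub (I : finType) (N N' : (I -> R) -> Prop) :
  (forall y, N' y -> N y) -> null_set N -> null_set N'.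
Proof.
move=> NN N0 e /N0[a [b [ab [cov len]]]]; exists a, b; split=> //; split=> // y /NN.
exact: cov.
Qed.

Section Filippov.
Variables (I : finType) (F : (I -> R) -> I -> R) (z v : I -> R).
Variable N : (I -> R) -> Prop.
Hypotheses (Fv : filippov_set F z v) (N0 : null_set N).

(** A bound near [z] and off [N] places the nearby values of [F] in a half-space, which the closed
    convex hull cannot leave. Only the bound [Psi] has to be continuous at [z], not [F]. *)
Lemma filippov_le a Psi : cont_at Psi z ->
  (forall y, norm (vsub y z) < 1 -> ~ N y -> dot a (F y) <= Psi y) -> dot a v <= Psi z.
Proof.
move=> cP le; apply: le_epsilon => e e0; have [d d0 Hd] := cP e e0.
apply: (Fv (Rmin_glb_lt _ _ _ Rlt_0_1 d0) N0) => _ [y [yz [Ny ->]]].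
have := Hd y (Rlt_le_trans _ _ _ yz (Rmin_r _ _)).
have := le y (Rlt_le_trans _ _ _ yz (Rmin_l _ _)) Ny.
by split_Rabs; lra.
Qed.

Lemma dot_coord (c : I) (e : R) u : dot (fun i => if i == c then e else 0) u = e * u c.
Proof.
rewrite /dot (bigD1 c) //= eqxx big1 ?Rplus_0_r // => i /negbTE ->; ring.
Qed.

Lemma filippov_coord c r :
  (forall y, norm (vsub y z) < 1 -> ~ N y -> F y c = r) -> v c = r.
Proof.
move=> Fr.
have H e : e * v c <= e * r.
  rewrite -(dot_coord c e v).
  apply: (@filippov_le _ (fun=> e * r)); first exact: cont_at_const.
  by move=> y yz Ny; rewrite dot_coord Fr //; lra.
by have := H 1; have := H (-1); lra.
Qed.

End Filippov.

Section ClosedLoop.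
Variables (n m : nat) (G : R -> rel 'I_n) (g : 'I_n -> ('I_m -> R) -> 'I_m -> R).
Variables (t : R) (z v : St n m -> R).
Hypothesis v_filippov : filippov_set (closed_loop G g t) z v.

(** Some coordinate must exist: in dimension zero every box has volume 1, the empty product, and no
    set is null. *)
Lemma null_empty (c1 c2 : St n m) : c1 != c2 -> null_set (fun=> False : Prop) (I := St n m).
Proof. by move=> c12; apply: (null_set_sub _ (null_diag z c12)). Qed.

(* The null set where agents i and j coincide is ignored by the Filippov
   regularization: gains keep growing at unit speed even at consensus. *)
Lemma gain_rate (k0 : 'I_m) i j :
  v (inr (i, j)) = if (i != j) && G t i j then 1 else 0.
Proof.
have c12 : (inl (i, k0) : St n m) != inr (i, i) by [].
have [ij|ij] /= := eqVneq i j.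
  (* [G] may have loops; their length is 0, so [sgn] keeps their gain constant. *)
  apply: (filippov_coord v_filippov (null_empty c12)) => y _ _ /=.
  rewrite ij (_ : norm _ = 0); last by apply/norm0P => k; rewrite /vsub; ring.
  rewrite /sgn; case: ifP => // _; case: Rlt_dec => ? /=; lra.
case Gij: (G t i j); last first.
  by apply: (filippov_coord v_filippov (null_empty c12)) => y _ _ /=; rewrite Gij.
have d12 : (inl (i, k0) : St n m) != inl (j, k0).
  by apply: contraNneq ij => -[->].
apply: (filippov_coord v_filippov (null_diag z d12)) => y yz Ny /=; rewrite Gij.
(* Coincident agents agree in coordinate [k0], so removing the diagonal of that one coordinate is
   enough. *)
rewrite /sgn; case: Rlt_dec => // np; case: Ny; split.
  have /norm0P/(_ k0) : norm (vsub (pos_of y j) (pos_of y i)) = 0.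
    by have := norm_ge0 (vsub (pos_of y j) (pos_of y i)); lra.
  by rewrite /vsub /pos_of /= => E; lra.
by move=> c; rewrite -/(vsub y z c); have := norm_coord (vsub y z) c; lra.
Qed.

Definition lift_pos (w : 'I_n -> 'I_m -> R) : St n m -> R :=
  fun c => if c is inl p then w p.1 p.2 else 0.

Lemma dot_lift_pos w (u : St n m -> R) :
  dot (lift_pos w) u = \big[Rplus/0]_i dot (w i) (pos_of u i).
Proof.
rewrite /dot big_sumType /= [X in _ + X]big1 ?Rplus_0_r; last by move=> *; ring.
by rewrite pair_bigA /=; apply: eq_bigr => -[i k] _.
Qed.

Hypothesis G_sym : forall i j, G t i j = G t j i.

(** Exchanging the ends of each edge and averaging the two expressions. The weights [y] are not
    taken symmetric: they will be the gains of states near [z], which need not be. *)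
Lemma antisym_sum (e : 'I_n -> 'I_n -> 'I_m -> R) (w : 'I_n -> 'I_m -> R)
    (y : 'I_n -> 'I_n -> R) :
  (forall i j k, e j i k = - e i j k) ->
  \big[Rplus/0]_i \big[Rplus/0]_(j | G t i j) (y i j * dot (w i) (e i j)) =
  / 2 * \big[Rplus/0]_i \big[Rplus/0]_(j | G t i j)
    dot (fun k => y i j * w i k - y j i * w j k) (e i j).
Proof.
move=> anti.
set S := \big[Rplus/0]_i _.
have E : S = - \big[Rplus/0]_i \big[Rplus/0]_(j | G t i j) (y j i * dot (w j) (e i j)).
  rewrite /S (exchange_big_dep xpredT) //= -sumR_opp; apply: eq_bigr => i _.
  rewrite -sumR_opp (eq_bigl (fun j => G t i j)) => [|j]; last by rewrite G_sym.
  apply: eq_bigr => j _.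
  rewrite (_ : dot (w j) (e i j) = - dot (w j) (e j i)); first by ring.
  by rewrite /dot -sumR_opp; apply: eq_bigr => k _; rewrite anti; ring.
set S' := \big[Rplus/0]_i _ in E.
suff : S - S' = \big[Rplus/0]_i \big[Rplus/0]_(j | G t i j)
    dot (fun k => y i j * w i k - y j i * w j k) (e i j) by lra.
rewrite /S /S' -sumR_sub; apply: eq_bigr => i _.
rewrite -sumR_sub; apply: eq_bigr => j _.
rewrite -!dotZl -dotBl //.
Qed.

Hypothesis g_cont : forall i, continuous_map (g i).
Hypothesis gain_sym : forall i j, gain_of z i j = gain_of z j i.
Hypothesis gain_ge0 : forall i j, 0 <= gain_of z i j.

Lemma cont_at_pos i k y : cont_at (fun y : St n m -> R => pos_of y i k) y.
Proof. exact: cont_at_coord. Qed.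

Lemma cont_at_gain i j y : cont_at (fun y : St n m -> R => gain_of y i j) y.
Proof. exact: cont_at_coord. Qed.

(* With e the unit vector along d, U.e <= |U + q d| - q |d|. The right-hand
   side is continuous in the state, unlike the control law itself. *)
Lemma filippov_work (k0 : 'I_m) (i0 : 'I_n) (w : 'I_n -> 'I_m -> R) :
  let U i j k := gain_of z i j *
    (w i k - w j k + (pos_of z j k - pos_of z i k)) in
  \big[Rplus/0]_i dot (w i) (pos_of v i) <=
  / 2 * \big[Rplus/0]_i \big[Rplus/0]_(j | G t i j)
     (norm (U i j) - gain_of z i j * norm (vsub (pos_of z j) (pos_of z i)))
  - \big[Rplus/0]_i dot (w i) (g i (pos_of z i)).
Proof.
move=> U.
(* The work of the coupling uses the gains of the varying state [y], but the multiple of the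
   displacement added to it keeps the gain of [z]. At [y = z], symmetry of the gains turns [V] into
   [U]. *)
pose V y i j k := gain_of y i j * w i k - gain_of y j i * w j k
  + gain_of z i j * (pos_of y j k - pos_of y i k).
pose Psi y := / 2 * \big[Rplus/0]_i \big[Rplus/0]_(j | G t i j)
     (norm (V y i j) - gain_of z i j * norm (vsub (pos_of y j) (pos_of y i)))
  - \big[Rplus/0]_i dot (w i) (g i (pos_of y i)).
have PsiE : Psi z = / 2 * \big[Rplus/0]_i \big[Rplus/0]_(j | G t i j)
     (norm (U i j) - gain_of z i j * norm (vsub (pos_of z j) (pos_of z i)))
  - \big[Rplus/0]_i dot (w i) (g i (pos_of z i)).
  rewrite /Psi; congr (_ * _ - _); apply: eq_bigr => i _; apply: eq_bigr => j _.
  by congr (_ - _); apply: eq_norm => k; rewrite /V /U (gain_sym j i); ring.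
rewrite -PsiE -dot_lift_pos.
have c12 : (inl (i0, k0) : St n m) != inr (i0, i0) by [].
apply: (filippov_le v_filippov (null_empty c12)).
  have cd i j k y : cont_at (fun y : St n m -> R => pos_of y j k - pos_of y i k) y.
    by apply: cont_at_sub; exact: cont_at_pos.
  have cgw i j (c : R) y : cont_at (fun y : St n m -> R => gain_of y i j * c) y.
    rewrite (_ : (fun y => _) = (fun y : St n m -> R => c * gain_of y i j)).
      by apply: cont_at_scal; exact: cont_at_gain.
    by apply: functional_extensionality => u; ring.
  apply: cont_at_sub; last first.
    apply: cont_at_sum => i _; apply: cont_at_sum => k _; apply: cont_at_scal.
    by apply: cont_at_map => // k'; exact: cont_at_pos.
  apply: cont_at_scal; apply: cont_at_sum => i _; apply: cont_at_sum => j _.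
  apply: cont_at_sub; last by apply: cont_at_scal; apply: cont_at_norm => k; exact: cd.
  apply: cont_at_norm => k; apply: cont_at_add; first by apply: cont_at_sub; exact: cgw.
  by apply: cont_at_scal; exact: cd.
move=> y _ _; rewrite dot_lift_pos.
pose d i j := vsub (pos_of y j) (pos_of y i).
pose e i j k := d i j k / norm (d i j).
have -> : \big[Rplus/0]_i dot (w i) (pos_of (closed_loop G g t y) i) =
    \big[Rplus/0]_i \big[Rplus/0]_(j | G t i j) (gain_of y i j * dot (w i) (e i j))
    - \big[Rplus/0]_i dot (w i) (g i (pos_of y i)).
  rewrite -sumR_sub; apply: eq_bigr => i _.
  have -> : \big[Rplus/0]_(j | G t i j) (gain_of y i j * dot (w i) (e i j)) =
      dot (w i) (fun k => \big[Rplus/0]_(j | G t i j) (gain_of y i j * e i j k)).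
    rewrite /dot.
    under [RHS]eq_bigr do rewrite big_distrr /=.
    rewrite [RHS]exchange_big /=; apply: eq_bigr => j _.
    by rewrite big_distrr; apply: eq_bigr => k _ /=; ring.
  rewrite -dotBr; apply: eq_dot => // k; rewrite /pos_of /vsub /=; congr (_ - _).
  by apply: eq_bigr => j _; rewrite /e /d /vsub /Rdiv Rmult_assoc.
rewrite (@antisym_sum e w (gain_of y)); last first.
  by move=> i j k; rewrite /e /d norm_sym /vsub /Rdiv; ring.
apply: Rplus_le_compat_r; apply: Rmult_le_compat_l; first by lra.
apply: sumR_le => i _; apply: sumR_le => j _; rewrite -/(d i j).
have -> : gain_of z i j * norm (d i j) = dot (fun k => gain_of z i j * d i j k) (e i j).
  by rewrite dotZl -[X in _ * X](norm_unit (d i j)).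
suff : dot (V y i j) (e i j) <= norm (V y i j).
  have -> : dot (V y i j) (e i j) =
      dot (fun k => gain_of y i j * w i k - gain_of y j i * w j k) (e i j)
      + dot (fun k => gain_of z i j * d i j k) (e i j) by exact: dotDl.
  by lra.
apply: Rle_trans (cauchy_schwarz _ _) _.
have := norm_unit_le (d i j); have := norm_ge0 (V y i j); rewrite -/(e i j).
by nra.
Qed.

(** With [w i] the offset of agent [i] from [c], the difference [w i - w j] cancels the
    displacement, so [U = 0]. The centre [c] is the origin for boundedness and the average for
    consensus. *)
Lemma filippov_energy (k0 : 'I_m) (i0 : 'I_n) (c : 'I_m -> R) :
  \big[Rplus/0]_i dot (vsub (pos_of z i) c) (pos_of v i) <=
  - / 2 * \big[Rplus/0]_i \big[Rplus/0]_(j | G t i j)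
     (gain_of z i j * norm (vsub (pos_of z j) (pos_of z i)))
  - \big[Rplus/0]_i dot (vsub (pos_of z i) c) (g i (pos_of z i)).
Proof.
apply: Rle_trans (filippov_work k0 i0 _) _; apply: Req_le; congr (_ - _).
rewrite Ropp_mult_distr_l_reverse Ropp_mult_distr_r -sumR_opp; congr (_ * _).
apply: eq_bigr => i _; rewrite -sumR_opp; apply: eq_bigr => j _.
rewrite (_ : norm _ = 0); first by ring.
by apply/norm0P => k; rewrite /vsub; ring.
Qed.

(** For a constant test vector, [U] is the gain times the displacement, and the two norms cancel
    because gains are nonnegative: the coupling does not move the mean. *)
Lemma filippov_mean (k0 : 'I_m) (i0 : 'I_n) (w : 'I_m -> R) :
  \big[Rplus/0]_i dot w (pos_of v i) <= - \big[Rplus/0]_i dot w (g i (pos_of z i)).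
Proof.
apply: Rle_trans (filippov_work k0 i0 (fun=> w)) _; apply: Req_le.
rewrite big1 ?Rmult_0_r ?Rminus_0_l // => i _; rewrite big1 // => j _.
rewrite (@eq_norm _ _ (fun k => gain_of z i j * vsub (pos_of z j) (pos_of z i) k)).
  by rewrite normZ Rabs_pos_eq //; ring.
by move=> k; rewrite /vsub; ring.
Qed.

End ClosedLoop.

(** * Trajectories *)

Lemma derivable_pt_lim_sum (J : finType) (F : J -> R -> R) (l : J -> R) t :
  (forall j, derivable_pt_lim (F j) t (l j)) ->
  derivable_pt_lim (fun s => \big[Rplus/0]_j F j s) t (\big[Rplus/0]_j l j).
Proof.
move=> dF; have -> : \big[Rplus/0]_j l j = \big[Rplus/0]_(j <- enum J) l j by rewrite big_enum.
have -> : (fun s => \big[Rplus/0]_j F j s) = (fun s => \big[Rplus/0]_(j <- enum J) F j s).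
  by apply: functional_extensionality => s; rewrite big_enum.
elim: (enum J) => [|j r IH].
  rewrite big_nil.
  have -> : (fun s => \big[Rplus/0]_(j <- [::]) F j s) = fun=> 0.
    by apply: functional_extensionality => s; rewrite big_nil.
  exact: derivable_pt_lim_const.
rewrite big_cons.
have -> : (fun s => \big[Rplus/0]_(i <- j :: r) F i s) =
          (fun s => F j s + \big[Rplus/0]_(i <- r) F i s).
  by apply: functional_extensionality => s; rewrite big_cons.
exact: derivable_pt_lim_plus.
Qed.

Lemma derivable_pt_lim_dot (J : finType) (p : R -> J -> R) (w : J -> R) t :
  (forall j, derivable_pt_lim (fun s => p s j) t (w j)) ->
  derivable_pt_lim (fun s => dot (p s) (p s)) t (2 * dot (p t) w).
Proof.
move=> dp; have -> : 2 * dot (p t) w = \big[Rplus/0]_j (w j * p t j + p t j * w j).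
  by rewrite /dot big_distrr; apply: eq_bigr => j _ /=; ring.
by apply: derivable_pt_lim_sum => j; exact: derivable_pt_lim_mult.
Qed.

Lemma Rabs_quot a h : Rabs (a / h) = Rabs a / Rabs h.
Proof. by rewrite /Rdiv Rabs_mult Rabs_inv. Qed.

(** Squaring removes the kink of the positive part, with remainder at most h^2. This yields a
    differentiable penalty for exceeding a level. *)
Lemma derivable_pt_lim_pos_sqr r :
  derivable_pt_lim (fun s => Rmax s 0 * Rmax s 0) r (2 * Rmax r 0).
Proof.
move=> e e0; exists (mkposreal e e0) => h h0 /= he.
have h2 : 0 < Rabs h by exact: Rabs_pos_lt.
have K : Rabs (Rmax (r + h) 0 * Rmax (r + h) 0 - Rmax r 0 * Rmax r 0 - 2 * Rmax r 0 * h)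
    <= Rabs h * Rabs h.
  have -> : Rabs h * Rabs h = h * h by split_Rabs; ring.
  apply: Rabs_le; rewrite /Rmax.
  by case: Rle_dec => ?; case: Rle_dec => ?; split; nra.
have -> : (Rmax (r + h) 0 * Rmax (r + h) 0 - Rmax r 0 * Rmax r 0) / h - 2 * Rmax r 0 =
  (Rmax (r + h) 0 * Rmax (r + h) 0 - Rmax r 0 * Rmax r 0 - 2 * Rmax r 0 * h) / h by field.
rewrite Rabs_quot; apply: Rle_lt_trans he.
apply: (Rmult_le_reg_r (Rabs h)) => //.
by rewrite /Rdiv Rmult_assoc Rinv_l ?Rmult_1_r //; lra.
Qed.

Lemma derivable_pt_lim_gradient (I : finType) (F : (I -> R) -> R) DF
    (p : R -> I -> R) (w : I -> R) t :
  has_gradient F DF -> (forall i, derivable_pt_lim (fun s => p s i) t (w i)) ->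
  derivable_pt_lim (fun s => F (p s)) t (dot (DF (p t)) w).
Proof.
move=> gF dp e e0.
pose C := norm w + 1; have w0 := norm_ge0 w; have C0 : 0 < C by rewrite /C; lra.
have G0 := norm_ge0 (DF (p t)).
(* One half of [e] absorbs the first-order remainder, whose increment has length at most [C * |h|].
   The other half, through [e2], absorbs the distance of the difference quotient [u] to [w]. *)
pose e1 := e / 2 / C; have e10 : 0 < e1 by do 2 (apply: Rdiv_lt_0_compat; try lra).
have [r [r0 Hr]] := gF (p t) e1 e10.
pose e2 := Rmin 1 (e / 2 / (norm (DF (p t)) + 1)).
have e20 : 0 < e2 by apply: Rmin_glb_lt; [lra | do 2 (apply: Rdiv_lt_0_compat; try lra)].
have I0 := pos_INR #|I|.
pose e3 := e2 / (INR #|I| + 1); have e30 : 0 < e3 by apply: Rdiv_lt_0_compat; lra.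
have e3E : e3 * (INR #|I| + 1) = e2 by rewrite /e3; field; lra.
have [d d0 Hd] : exists2 d, 0 < d & forall i h, h <> 0 -> Rabs h < d ->
    Rabs ((p (t + h) i - p t i) / h - w i) < e3.
  apply: (@fin_min I (fun i d => forall h, h <> 0 -> Rabs h < d ->
    Rabs ((p (t + h) i - p t i) / h - w i) < e3)).
    by move=> i; have [d Hd] := dp i e3 e30; exists d => //; exact: cond_pos.
  by move=> i d d' H dd h h0 hd; apply: H => //; lra.
have rC : 0 < r / C by exact: Rdiv_lt_0_compat.
exists (mkposreal _ (Rmin_glb_lt _ _ _ d0 rC)) => h h0 /= hd.
have hd1 := Rlt_le_trans _ _ _ hd (Rmin_l _ _).
have hd2 := Rlt_le_trans _ _ _ hd (Rmin_r _ _).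
have h1 : 0 < Rabs h by exact: Rabs_pos_lt.
pose u i := (p (t + h) i - p t i) / h.
have uw : norm (vsub u w) < e2.
  apply: Rle_lt_trans (norm_le_sum _) _.
  apply: (@Rle_lt_trans _ (INR #|I| * e3)); last by lra.
  by rewrite -sumR_const; apply: sumR_le => i _; apply/Rlt_le/Hd.
have e21 : e2 <= 1 by exact: Rmin_l.
have uC : norm u <= C.
  have := norm_triang (vsub u w) w.
  by rewrite (@eq_norm _ _ u) => [|i]; [rewrite /C; lra | rewrite /vsub; ring].
have pE : vsub (p (t + h)) (p t) =1 (fun i => h * u i).
  by move=> i; rewrite /vsub /u; field.
have nE : norm (vsub (p (t + h)) (p t)) = Rabs h * norm u by rewrite (eq_norm pE) normZ.
have hC : Rabs h * C < r.
  by rewrite -(_ : r / C * C = r); [apply: Rmult_lt_compat_r | field; lra].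
have n0 := norm_ge0 u.
have := Hr (p (t + h)); rewrite nE (eq_dot (fun=> erefl) pE) dotZr => K.
have {}K := K ltac:(nra).
have -> : (F (p (t + h)) - F (p t)) / h - dot (DF (p t)) w =
   (F (p (t + h)) - F (p t) - h * dot (DF (p t)) u) / h + dot (DF (p t)) (vsub u w).
  by rewrite dotBr; field.
apply: Rle_lt_trans (Rabs_triang _ _) _.
have K1 : Rabs ((F (p (t + h)) - F (p t) - h * dot (DF (p t)) u) / h) <= e / 2.
  rewrite Rabs_quot; apply: (Rmult_le_reg_r (Rabs h)) => //.
  rewrite /Rdiv Rmult_assoc Rinv_l ?Rmult_1_r; last by lra.
  apply: Rle_trans K _.
  have -> : e * / 2 = e1 * C by rewrite /e1; field; lra.
  have : Rabs h * norm u <= Rabs h * C by apply: Rmult_le_compat_l; lra.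
  by nra.
have K2 : Rabs (dot (DF (p t)) (vsub u w)) < e / 2.
  have := cauchy_schwarz (DF (p t)) (vsub u w).
  have := cauchy_schwarz (DF (p t)) (vsub w u); rewrite norm_sym.
  rewrite (_ : dot (DF (p t)) (vsub w u) = - dot (DF (p t)) (vsub u w)); last first.
    by rewrite !dotBr; ring.
  set a := dot _ _; set b := norm (vsub u w) in uw *.
  have : (norm (DF (p t)) + 1) * (e / 2 / (norm (DF (p t)) + 1)) = e / 2 by field; lra.
  have : e2 <= e / 2 / (norm (DF (p t)) + 1) by exact: Rmin_r.
  have := norm_ge0 (vsub u w); rewrite -/b.
  set c := e / 2 / _ => b0 ec cE A1 A2.
  have : norm (DF (p t)) * b < e / 2.
    by rewrite -cE; nra.
  by split_Rabs; lra.
by lra.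
Qed.

(** * Mean position and distances along paths of the graph *)

Section Average.
Variables (n m : nat).
Hypothesis n_gt0 : (0 < n)%N.
Implicit Types (X V : 'I_n -> 'I_m -> R).

Let INRn : 0 < INR n.
Proof. exact/lt_0_INR/ltP. Qed.

Lemma dot_avg (w : 'I_m -> R) V : dot w (avg V) = / INR n * \big[Rplus/0]_i dot w (V i).
Proof. by rewrite dotZr dot_sumr. Qed.

Lemma sum_center X (w : 'I_m -> R) : \big[Rplus/0]_i dot (vsub (X i) (avg X)) w = 0.
Proof.
under eq_bigr => i _ do rewrite dotBl (dotC (X i)) (dotC (avg X)) dot_avg.
rewrite sumR_sub sumR_const card_ord; set S := \big[Rplus/0]_i _.
by field; lra.
Qed.

(** Triangle inequality along a path shortened to have no repeated vertex, hence at most [n]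
    edges. *)
Lemma dist_connect (e : rel 'I_n) X (D : R) a b :
  0 <= D -> (forall i j, e i j -> norm (vsub (X j) (X i)) <= D) -> connect e a b ->
  norm (vsub (X b) (X a)) <= INR n * D.
Proof.
move=> D0 eD /connectP[p0 /shortenP[p ep up _] ->].
have pn : (size p <= n)%N.
  have := max_card (mem (a :: p)); rewrite (card_uniqP up) card_ord; exact: ltnW.
apply: (@Rle_trans _ (INR (size p) * D)); last first.
  by apply: Rmult_le_compat_r => //; exact/le_INR/leP.
elim: p a ep {up pn p0} => [|c p IH] a.
  move=> _; rewrite /= (_ : norm _ = 0); first by lra.
  by apply/norm0P => k; rewrite /vsub; ring.
move=> /andP[ac /IH {}IH]; rewrite [size _]/= S_INR /=.
apply: Rle_trans (norm_sub_triang _ (X c) _) _.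
by rewrite Rmult_plus_distr_r Rmult_1_l; exact: Rplus_le_compat IH (eD _ _ ac).
Qed.

Lemma dist_avg X (D : R) i : (forall j, norm (vsub (X i) (X j)) <= D) ->
  norm (vsub (X i) (avg X)) <= D.
Proof.
move=> XD.
have E : vsub (X i) (avg X) =1 (fun k => / INR n * \big[Rplus/0]_j vsub (X i) (X j) k).
  move=> k; rewrite /vsub sumR_sub sumR_const card_ord /avg.
  by rewrite Rmult_minus_distr_l -Rmult_assoc Rinv_l ?Rmult_1_l //; lra.
rewrite (eq_norm E) normZ Rabs_pos_eq; last exact/Rlt_le/Rinv_0_lt_compat.
apply: (Rmult_le_reg_l (INR n)) => //; rewrite -Rmult_assoc Rinv_r ?Rmult_1_l; last by lra.
apply: Rle_trans (norm_sum _) _.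
have -> : INR n * D = \big[Rplus/0]_(j < n) D by rewrite sumR_const card_ord.
by apply: sumR_le => j _; exact: XD.
Qed.

Lemma avg_const X i : (forall i j k, X i k = X j k) -> avg X = X i.
Proof.
move=> Xc; apply: functional_extensionality => k; rewrite /avg.
rewrite (eq_bigr (fun=> X i k)) => [|j _]; last exact: Xc.
by rewrite sumR_const card_ord; field; lra.
Qed.

End Average.

(** * A fixed trajectory and the growth of its gains *)

Section Trajectory.
Variables (n m : nat) (G : R -> rel 'I_n) (dw : R).
Variables (f : 'I_n -> ('I_m -> R) -> R) (g : 'I_n -> ('I_m -> R) -> ('I_m -> R)).
Variables (x : R -> 'I_n -> 'I_m -> R) (q : R -> 'I_n -> 'I_n -> R).
Hypothesis f_convex : forall i, convex_fun (f i).
Hypothesis f_grad : forall i, has_gradient (f i) (g i).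
Hypothesis g_cont : forall i, continuous_map (g i).
Hypothesis G_sym : forall t, 0 <= t -> forall i j, G t i j = G t j i.
Hypothesis G_conn : forall t, 0 <= t -> forall i j, connect (G t) i j.
Hypothesis f_min : forall i, (exists s, forall k, g i s k = 0) /\
             bounded_set (fun s => forall k, g i s k = 0).
Hypothesis dw_gt0 : 0 < dw.
Hypothesis G_dwell : dwell_time G dw.
Hypothesis q_init : forall i j, q 0 i j = 0.
Hypothesis sol : filippov_solution (closed_loop G g) (fun t => pack (x t) (q t)).
Variables (i0 : 'I_n) (k0 : 'I_m).

Let n_gt0 : (0 < n)%N.
Proof. exact: leq_ltn_trans (leq0n _) (ltn_ord i0). Qed.

Let INRn : 1 <= INR n.
Proof. by have /leP/le_INR := n_gt0. Qed.

Let velocity t (v : St n m -> R) :=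
  (forall c, derivable_pt_lim (fun s => pack (x s) (q s) c) t (v c)) /\
  filippov_set (closed_loop G g t) (pack (x t) (q t)) v.

Lemma state_ac c a b : 0 <= a <= b -> abs_cont_on (fun t => pack (x t) (q t) c) a b.
Proof.
move=> ab; have [ac _] := sol; apply: (@abs_cont_restrict _ a b 0 b); try lra.
by apply: ac; lra.
Qed.

Lemma pos_ac i k a b : 0 <= a <= b -> abs_cont_on (fun t => x t i k) a b.
Proof. exact: (@state_ac (inl (i, k))). Qed.

Lemma gain_ac i j a b : 0 <= a <= b -> abs_cont_on (fun t => q t i j) a b.
Proof. exact: (@state_ac (inr (i, j))). Qed.

(** Hides the exceptional null set of the solution: a derivative bound is asked only at times where
    the state has a velocity in its Filippov set. *)
Lemma traj_le h a b c : 0 <= a <= b -> abs_cont_on h a b ->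
  (forall t v, a <= t <= b -> velocity t v -> exists l, derivable_pt_lim h t l /\ l <= c) ->
  h b - h a <= c * (b - a).
Proof.
move=> ab ac dh; have [_ N0] := sol.
apply: (abs_cont_incr_le _ ac N0); first by lra.
move=> t tab Nt; suff [v Hv] : exists v, velocity t v by exact: (dh t v).
by apply: NNPP => no; apply: Nt; split=> //; lra.
Qed.

Lemma traj_ge h a b c : 0 <= a <= b -> abs_cont_on h a b ->
  (forall t v, a <= t <= b -> velocity t v -> exists l, derivable_pt_lim h t l /\ c <= l) ->
  c * (b - a) <= h b - h a.
Proof.
move=> ab ac dh; have [_ N0] := sol.
apply: (abs_cont_incr_ge _ ac N0); first by lra.
move=> t tab Nt; suff [v Hv] : exists v, velocity t v by exact: (dh t v).
by apply: NNPP => no; apply: Nt; split=> //; lra.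
Qed.

Lemma gain_derivable t v i j : velocity t v ->
  derivable_pt_lim (fun s => q s i j) t (if (i != j) && G t i j then 1 else 0).
Proof. by move=> [dv fv]; rewrite -(gain_rate fv k0); exact: (dv (inr (i, j))). Qed.

Lemma gain_mono s t i j : 0 <= s <= t -> q s i j <= q t i j.
Proof.
move=> st; suff : 0 * (t - s) <= q t i j - q s i j by lra.
apply: (traj_ge (h := fun s => q s i j)) => //; first exact: gain_ac.
move=> r v _ /(gain_derivable i j) dq; eexists; split; first exact: dq.
by case: (_ && _); lra.
Qed.

Lemma gain_ge0 t i j : 0 <= t -> 0 <= q t i j.
Proof. by move=> t0; rewrite -(q_init i j); apply: gain_mono; lra. Qed.

Lemma gain_sym t i j : 0 <= t -> q t i j = q t j i.
Proof.
move=> t0.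
have H a b : q t a b <= q t b a.
  have t00 : 0 <= 0 <= t by lra.
  have : (q t a b - q t b a) - (q 0 a b - q 0 b a) <= 0 * (t - 0).
    apply: (traj_le (h := fun s => q s a b - q s b a)) => //.
      by apply: abs_cont_minus; exact: gain_ac.
    move=> r v rt rv; exists 0; split; last by lra.
    have := derivable_pt_lim_minus _ _ _ _ _ (gain_derivable a b rv) (gain_derivable b a rv).
    by rewrite eq_sym (G_sym (t := r)) ?Rminus_diag //; lra.
  by rewrite !q_init; lra.
by apply: Rle_antisym.
Qed.

(** For one pair there are three cases. The gain reaches [M] and, being monotone, stays above it; or
    the edge is absent from some switching time on; or it recurs in arbitrarily late dwell
    intervals, each adding [dw], so that [M] is reached after all. *)
Lemma gain_eventually (M : R) : exists T, 0 <= T /\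
  forall t, T <= t -> forall i j, i != j -> G t i j -> M <= q t i j.
Proof.
have [tau [tau0 [tau_dw tau_G]]] := G_dwell.
have tau_mono k p : (k <= p)%N -> tau k <= tau p.
  move=> /subnK <-; elim: (p - k)%N => [|r IH]; first by rewrite add0n; lra.
  by rewrite addSn; have := tau_dw (r + k)%N; lra.
have tau_ge0 k : 0 <= tau k by rewrite -tau0; exact: tau_mono.
have tau_large B : exists k, B < tau k.
  have [k Hk] := INR_unbounded (B / dw); exists k.
  have : INR k * dw <= tau k.
    by elim: {Hk} k => [|k IH]; [rewrite tau0 /=; lra | rewrite S_INR; have := tau_dw k; lra].
  have : B / dw * dw = B by field; lra.
  by nra.
have grow i j k : i != j -> G (tau k) i j -> q (tau k) i j + dw <= q (tau k.+1) i j.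
  move=> ij Gk; apply: le_epsilon => e e0; have Dk := tau_dw k; have T0 := tau_ge0 k.
  (* The graph is constant on a half-open interval, so growth is measured up to some [s < tau k.+1],
     losing at most [e]. *)
  pose s := Rmax (tau k) (tau k.+1 - e).
  have s1 : tau k <= s by exact: Rmax_l.
  have s2 : tau k.+1 - e <= s by exact: Rmax_r.
  have s3 : s < tau k.+1 by apply: Rmax_lub_lt; lra.
  have ks : 0 <= tau k <= s by lra.
  have := @traj_ge (fun s => q s i j) _ _ 1 ks (gain_ac _ _ ks).
  have := @gain_mono s (tau k.+1) i j ltac:(lra).
  move=> H1 H2; suff : 1 * (s - tau k) <= q s i j - q (tau k) i j by lra.
  apply: H2 => t v tk /(gain_derivable i j).
  rewrite ij (tau_G k) ?Gk /=; last by lra.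
  by move=> dq; exists 1; split=> //; lra.
have pair i j : exists T, 0 <= T /\ forall t, T <= t -> i != j -> G t i j -> M <= q t i j.
  have [ij|ij] := eqVneq i j; first by exists 0; split=> //; lra.
  have [[s [s0 sM]]|no] := classic (exists s, 0 <= s /\ M <= q s i j).
    by exists s; split=> // t st _ _; apply: Rle_trans sM _; exact: gain_mono.
  have [[K HK]|inf] := classic (exists K, forall k, (K <= k)%N -> ~~ G (tau k) i j).
    exists (tau K); split=> // t Kt _ Gt.
    have [k Kk kt] : exists2 k, (K <= k)%N & tau k <= t < tau k.+1.
      have [p Hp] := tau_large t.
      have : forall r, exists2 k, (K <= k)%N & tau k <= t /\ ((k < K + r)%N -> t < tau k.+1).
        elim=> [|r [k Kk [kt Hk]]]; first by exists K => //; split=> //; rewrite addn0 ltnn.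
        have [rt|tr] := Rle_lt_dec (tau (K + r.+1)%N) t.
          by exists (K + r.+1)%N; [exact: leq_addr | split=> //; rewrite ltnn].
        exists k => //; split=> //; rewrite addnS ltnS leq_eqVlt => /orP[/eqP E|/Hk//].
        by rewrite E -addnS.
      move=> /(_ p)[k Kk [kt Hk]]; exists k => //; split=> //; apply: Hk.
      rewrite ltnNge; apply/negP => pk.
      by have := tau_mono _ _ (leq_trans (leq_addl K p) pk); lra.
    by move: Gt; rewrite (tau_G k t kt) (negbTE (HK k Kk)).
  case: no.
  have [p Hp] := INR_unbounded (M / dw).
  have : M <= INR p * dw.
    by have : M / dw * dw = M by [field; lra]; nra.
  suff [s [s0 Hs]] : exists s, 0 <= s /\ INR p * dw <= q s i j by move=> ?; exists s; split=> //; lra.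
  (* Each step waits for a reappearance of the edge after [s] and collects another [dw]. *)
  elim: {Hp} p => [|p [s [s0 Hs]]].
    by exists 0; rewrite q_init /=; lra.
  have [K HK] := tau_large s.
  have [k [Kk Gk]] : exists k, (K <= k)%N /\ G (tau k) i j.
    apply: NNPP => no; apply: inf; exists K => k Kk; apply/negP => Gk.
    by apply: no; exists k.
  exists (tau k.+1); split=> //; rewrite S_INR.
  have := grow i j k ij Gk; have := tau_mono _ _ Kk.
  by have := @gain_mono s (tau k) i j; have := tau_mono _ _ Kk; lra.
have [T HT] : exists T, forall p : 'I_n * 'I_n, 0 <= T /\ forall t, T <= t ->
    p.1 != p.2 -> G t p.1 p.2 -> M <= q t p.1 p.2.
  apply: (@fin_max _ (fun p T => 0 <= T /\ forall t, T <= t ->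
    p.1 != p.2 -> G t p.1 p.2 -> M <= q t p.1 p.2)); first by move=> [i j]; exact: pair.
  by move=> p T T' [T0 H] TT; split=> [|t Tt]; [lra | apply: H; lra].
exists T; split; first by case: (HT (i0, i0)).
by move=> t Tt i j; apply: (proj2 (HT (i, j))).
Qed.

Lemma traj_energy t v c : 0 <= t -> velocity t v ->
  \big[Rplus/0]_i dot (vsub (x t i) c) (pos_of v i) <=
  - / 2 * \big[Rplus/0]_i \big[Rplus/0]_(j | G t i j)
     (q t i j * norm (vsub (x t j) (x t i)))
  - \big[Rplus/0]_i dot (vsub (x t i) c) (g i (x t i)).
Proof.
move=> t0 [_ fv]; exact: (filippov_energy fv (G_sym t0) g_cont (fun i j => gain_sym i j t0) k0 i0 c).
Qed.

Lemma traj_mean t v w : 0 <= t -> velocity t v ->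
  \big[Rplus/0]_i dot w (pos_of v i) <= - \big[Rplus/0]_i dot w (g i (x t i)).
Proof.
move=> t0 [_ fv]; exact: (filippov_mean fv (G_sym t0) g_cont (fun i j => gain_sym i j t0)
  (fun i j => gain_ge0 i j t0) k0 i0 w).
Qed.

(** * Boundedness of the agents and of their gradients *)

Lemma uniform_growth : exists c C, 0 < c /\ forall i u, c * norm u - C <= f i u.
Proof.
have gr i := convex_growth (f_grad i) (@f_convex i) (proj1 (f_min i)) (proj2 (f_min i)).
have [c c0 Hc] : exists2 c, 0 < c & forall i, exists C, forall u, c * norm u - C <= f i u.
  apply: (@fin_min _ (fun i c => exists C, forall u, c * norm u - C <= f i u)).
    by move=> i; have [c [C [c0 H]]] := gr i; exists c => //; exists C.
  move=> i c c' [C H] cc; exists C => u; apply: Rle_trans (H u).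
  by have := norm_ge0 u; nra.
have [C HC] : exists C, forall i, forall u, c * norm u - C <= f i u.
  apply: (@fin_max _ (fun i C => forall u, c * norm u - C <= f i u)) => //.
  by move=> i C C' H CC u; have := H u; lra.
by exists c, C.
Qed.

Lemma sq_norm_le_sum (X : 'I_n -> 'I_m -> R) :
  \big[Rplus/0]_i dot (X i) (X i) <=
  (\big[Rplus/0]_i norm (X i)) * (\big[Rplus/0]_i norm (X i)).
Proof.
rewrite [X in _ <= X]big_distrr /=; apply: sumR_le => i _; rewrite -norm_sqr.
apply: Rmult_le_compat_r; first exact: norm_ge0.
by apply: (@sumR_term _ xpredT (fun i => norm (X i))) => // j _; exact: norm_ge0.
Qed.

(** With N the sum of the norms, half the derivative of [V] is at most F0 + n C - c N, which is
    nonpositive once N reaches [K]. As V <= N^2, this covers all states with V > K^2, so [V] never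
    exceeds [B]. *)
Lemma traj_bounded : exists B, forall t i, 0 <= t -> norm (x t i) <= B.
Proof.
have [c [C [c0 growth]]] := uniform_growth.
pose F0 := \big[Rplus/0]_i f i (fun=> 0).
pose K := Rmax 0 ((INR n * C + F0) / c).
have K0 : 0 <= K by exact: Rmax_l.
have cK : INR n * C + F0 <= c * K.
  have := Rmax_r 0 ((INR n * C + F0) / c); rewrite -/K => H.
  by rewrite (_ : INR n * C + F0 = c * ((INR n * C + F0) / c)); [nra | field; lra].
pose V t := \big[Rplus/0]_i dot (x t i) (x t i).
pose B := Rmax (V 0) (K * K).
(* The sign of the derivative of [V] is known only above [B]; [W] ignores everything below, starts
   at 0 and never increases. *)
pose W t := Rmax (V t - B) 0 * Rmax (V t - B) 0.
have V_ac a b : 0 <= a <= b -> abs_cont_on V a b.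
  move=> ab; apply: abs_cont_sum => i; apply: abs_cont_sum => k.
  by apply: abs_cont_sqr; [lra | exact: pos_ac].
have VB t : 0 <= t -> V t <= B.
  move=> t0.
  have : W t - W 0 <= 0 * (t - 0).
    apply: (traj_le (h := W)); first by lra.
      apply: abs_cont_sqr => //; apply: (abs_cont_lip (V_ac 0 t ltac:(lra)) (L := 1)).
      move=> r s _ _; rewrite /Rmax.
      by case: Rle_dec => ?; case: Rle_dec => ?; split_Rabs; lra.
    move=> s v st sv; have s0 : 0 <= s by lra.
    pose dV := \big[Rplus/0]_i (2 * dot (x s i) (pos_of v i)).
    exists (2 * Rmax (V s - B) 0 * (dV - 0)); split.
      apply: (derivable_pt_lim_comp (fun t => V t - B) (fun r => Rmax r 0 * Rmax r 0)).
        apply: derivable_pt_lim_minus (derivable_pt_lim_const B s).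
        apply: derivable_pt_lim_sum => i; apply: derivable_pt_lim_dot => k.
        exact: (proj1 sv (inl (i, k))).
      exact: derivable_pt_lim_pos_sqr.
    have [VB|BV] := Rle_lt_dec (V s - B) 0; first by rewrite Rmax_right //; lra.
    suff : dV <= 0 by have := Rmax_r (V s - B) 0; nra.
    have := traj_energy (fun=> 0) s0 sv.
    rewrite (eq_bigr (fun i => dot (x s i) (pos_of v i))) => [|i _]; last first.
      by apply: eq_dot => // k; rewrite /vsub; ring.
    have : 0 <= \big[Rplus/0]_i \big[Rplus/0]_(j | G s i j)
        (q s i j * norm (vsub (x s j) (x s i))).
      apply: sumR_ge0 => i _; apply: sumR_ge0 => j _.
      by apply: Rmult_le_pos; [exact: gain_ge0 | exact: norm_ge0].
    have : \big[Rplus/0]_i (f i (x s i) - f i (fun=> 0)) <=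
        \big[Rplus/0]_i dot (vsub (x s i) (fun=> 0)) (g i (x s i)).
      by apply: sumR_le => i _; exact: (convex_gradient_le (f_grad i) (@f_convex i)).
    rewrite sumR_sub -/F0.
    have : \big[Rplus/0]_i (c * norm (x s i) - C) <= \big[Rplus/0]_i f i (x s i).
      by apply: sumR_le => i _; exact: growth.
    rewrite sumR_sub sumR_const card_ord -big_distrr /= /dV -big_distrr /=.
    set N := \big[Rplus/0]_i norm _; set A := \big[Rplus/0]_i dot (x s i) _.
    have KN : K <= N.
      have N0 : 0 <= N by apply: sumR_ge0 => i _; exact: norm_ge0.
      have := sq_norm_le_sum (x s); rewrite -/(V s) -/N.
      by have := Rmax_r (V 0) (K * K); rewrite -/B; nra.
    by have := Rmult_le_compat_l c K N ltac:(lra) KN; lra.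
  rewrite /W (Rmax_right (V 0 - B) 0); last by have := Rmax_l (V 0) (K * K); rewrite -/B; lra.
  have := Rmax_l (V t - B) 0; have := Rmax_r (V t - B) 0.
  by nra.
exists (sqrt B) => t i t0; apply: sqrt_le_1_alt; apply: Rle_trans (VB t t0).
by apply: (@sumR_term _ xpredT (fun i => dot (x t i) (x t i))) => // j _; exact: dot_ge0.
Qed.

Lemma gradient_bounded B : exists L, 0 <= L /\ forall i u, norm u <= B -> norm (g i u) <= L.
Proof.
have [L HL] : exists L, forall i, 0 <= L /\ forall u, norm u <= B -> norm (g i u) <= L.
  apply: (@fin_max _ (fun i L => 0 <= L /\ forall u, norm u <= B -> norm (g i u) <= L)).
    move=> i; have [|M HM] := @cont_bounded _ (fun u => norm (g i u)) B.
      move=> u; apply: cont_at_norm => k; apply: (cont_at_map (p := id)) => // j.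
      exact: cont_at_coord.
    exists (Rmax 0 M); split; first exact: Rmax_l.
    by move=> u /HM uM; apply: Rle_trans uM (Rmax_r _ _).
  by move=> i L L' [L0 H] LL; split=> [|u /H]; lra.
by exists L; split=> [|i]; [case: (HL i0) | case: (HL i)].
Qed.

(** * Decay of the spread and consensus in finite time *)

Lemma avg_ac k a b : 0 <= a <= b -> abs_cont_on (fun t => avg (x t) k) a b.
Proof.
move=> ab; have := @abs_cont_sum _ (fun i t => x t i k) a b (fun i => pos_ac i k ab).
move=> ac; apply: (abs_cont_lip ac (L := Rabs (/ INR n))) => s t _ _.
by rewrite /avg -Rmult_minus_distr_l Rabs_mult; exact: Rle_refl.
Qed.

Lemma avg_derivable t v k : velocity t v ->
  derivable_pt_lim (fun s => avg (x s) k) t (avg (pos_of v) k).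
Proof.
move=> [dv _]; apply: derivable_pt_lim_scal.
by apply: (derivable_pt_lim_sum (F := fun i s => x s i k)) => i; exact: (dv (inl (i, k))).
Qed.

Definition spread (X : 'I_n -> 'I_m -> R) : R :=
  \big[Rplus/0]_i dot (vsub (X i) (avg X)) (vsub (X i) (avg X)).

Lemma spread_ge0 X : 0 <= spread X.
Proof. by apply: sumR_ge0 => i _; exact: dot_ge0. Qed.

Lemma spread0 X : spread X = 0 -> forall i j k, X i k = X j k.
Proof.
move=> X0; have H i k : X i k = avg X k.
  have : dot (vsub (X i) (avg X)) (vsub (X i) (avg X)) <= 0.
    rewrite -X0; apply: (@sumR_term _ xpredT
      (fun i => dot (vsub (X i) (avg X)) (vsub (X i) (avg X)))) => // j _.
    exact: dot_ge0.
  rewrite -norm_sqr => n0.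
  have /norm0P/(_ k) : norm (vsub (X i) (avg X)) = 0.
    by have := norm_ge0 (vsub (X i) (avg X)); nra.
  by rewrite /vsub; lra.
by move=> i j k; rewrite !H.
Qed.

Lemma spread_ac a b : 0 <= a <= b -> abs_cont_on (fun t => spread (x t)) a b.
Proof.
move=> ab; apply: abs_cont_sum => i; apply: abs_cont_sum => k.
apply: abs_cont_sqr; first by lra.
by apply: abs_cont_minus; [exact: pos_ac | exact: avg_ac].
Qed.

(** The velocity of the average drops out, because the deviations from the average sum to zero. *)
Lemma spread_derivable t v : velocity t v ->
  derivable_pt_lim (fun s => spread (x s)) t
    (2 * \big[Rplus/0]_i dot (vsub (x t i) (avg (x t))) (pos_of v i)).
Proof.
move=> tv.
have -> : 2 * \big[Rplus/0]_i dot (vsub (x t i) (avg (x t))) (pos_of v i) =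
    \big[Rplus/0]_i (2 * dot (vsub (x t i) (avg (x t))) (vsub (pos_of v i) (avg (pos_of v)))).
  rewrite -big_distrr /=; congr (_ * _).
  under [RHS]eq_bigr do rewrite dotBr.
  by rewrite sumR_sub (sum_center n_gt0) Rminus_0_r.
apply: (derivable_pt_lim_sum (F := fun i s =>
  dot (vsub (x s i) (avg (x s))) (vsub (x s i) (avg (x s))))) => i.
apply: (derivable_pt_lim_dot (p := fun s => vsub (x s i) (avg (x s)))) => k.
apply: derivable_pt_lim_minus; last exact: avg_derivable.
exact: (proj1 tv (inl (i, k))).
Qed.

(** Let [D] be the sum of edge lengths over ordered pairs. Connectivity gives [S <= n^2 * D]. The
    coupling contributes at most [- M * D / 2] and the gradients at most [L * S]; with
    [M = 2 * n^2 * (L + 1)] the sum is at most [- n^2 * D], hence at most [- S]. *)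
Lemma spread_decay : exists T, 0 <= T /\ forall t v, T <= t -> velocity t v ->
  2 * \big[Rplus/0]_i dot (vsub (x t i) (avg (x t))) (pos_of v i)
    <= - 2 * sqrt (spread (x t)).
Proof.
have [B HB] := traj_bounded; have [L [L0 HL]] := gradient_bounded B.
pose M := 2 * INR n * INR n * (L + 1).
have [T [T0 HT]] := gain_eventually M.
exists T; split=> // t v Tt tv; have t0 : 0 <= t by lra.
pose D := \big[Rplus/0]_i \big[Rplus/0]_(j | G t i j) norm (vsub (x t j) (x t i)).
have D0 : 0 <= D by do 2 (apply: sumR_ge0 => ? _); exact: norm_ge0.
have eD i j : G t i j -> norm (vsub (x t j) (x t i)) <= D.
  move=> Gij; apply: (@Rle_trans _ (\big[Rplus/0]_(j | G t i j) norm (vsub (x t j) (x t i)))).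
    apply: (@sumR_term _ (fun j => G t i j) (fun j => norm (vsub (x t j) (x t i)))) => // k _.
    exact: norm_ge0.
  apply: (@sumR_term _ xpredT (fun i => \big[Rplus/0]_(j | G t i j)
    norm (vsub (x t j) (x t i)))) => // k _.
  by apply: sumR_ge0 => ? _; exact: norm_ge0.
have wD i : norm (vsub (x t i) (avg (x t))) <= INR n * D.
  by apply: dist_avg => // j; apply: dist_connect D0 eD (G_conn t0 j i).
pose S := \big[Rplus/0]_i norm (vsub (x t i) (avg (x t))).
have SD : S <= INR n * (INR n * D).
  have -> : INR n * (INR n * D) = \big[Rplus/0]_(i < n) (INR n * D).
    by rewrite sumR_const card_ord.
  by apply: sumR_le => i _; exact: wD.
have S0 : 0 <= S by apply: sumR_ge0 => i _; exact: norm_ge0.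
have spreadS : sqrt (spread (x t)) <= S.
  by rewrite -(sqrt_square S) //; apply: sqrt_le_1_alt; exact: sq_norm_le_sum.
have := traj_energy (avg (x t)) t0 tv.
have : M * D <= \big[Rplus/0]_i \big[Rplus/0]_(j | G t i j)
     (q t i j * norm (vsub (x t j) (x t i))).
  rewrite /D big_distrr /=; apply: sumR_le => i _.
  rewrite big_distrr /=; apply: sumR_le => j Gij.
  (* The gain of a loop has no lower bound, but its length is 0. *)
  have [->|ij] := eqVneq i j.
    rewrite (_ : norm _ = 0); first by lra.
    by apply/norm0P => k; rewrite /vsub; ring.
  by apply: Rmult_le_compat_r (norm_ge0 _) _; exact: HT.
have : - (L * S) <= \big[Rplus/0]_i dot (vsub (x t i) (avg (x t))) (g i (x t i)).
  rewrite /S big_distrr /= -sumR_opp; apply: sumR_le => i _.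
  have := cauchy_schwarz (vsub (avg (x t)) (x t i)) (g i (x t i)).
  rewrite norm_sym dotBl (dotBl _ (x t i)).
  have := Rmult_le_compat_l _ _ _ (norm_ge0 (vsub (x t i) (avg (x t)))) (HL i _ (HB t i t0)).
  by lra.
set Q := \big[Rplus/0]_i \big[Rplus/0]_(j | _) _; set P := \big[Rplus/0]_i _.
set E := \big[Rplus/0]_i _ => H1 H2 H3.
have : L * S <= L * (INR n * (INR n * D)) by exact: Rmult_le_compat_l.
by move: H2; rewrite /M; lra.
Qed.

Lemma finite_time_consensus :
  exists T, 0 <= T /\ forall t, T <= t -> forall i j k, x t i k = x t j k.
Proof.
have [T0 [T00 decay]] := spread_decay.
have mono s t : T0 <= s <= t -> spread (x t) <= spread (x s).
  move=> st; suff : spread (x t) - spread (x s) <= 0 * (t - s) by lra.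
  apply: (traj_le (h := fun t => spread (x t))); first by lra.
    by apply: spread_ac; lra.
  move=> r v rt rv; eexists; split; first exact: (spread_derivable rv).
  by have := decay r v ltac:(lra) rv; have := sqrt_pos (spread (x r)); lra.
(* At unit speed the square root would reach 0 by [T - 1]; the extra unit makes the contradiction
   strict. *)
pose T := T0 + sqrt (spread (x T0)) + 1.
have T1 : T0 + 1 <= T by have := sqrt_pos (spread (x T0)); rewrite /T; lra.
exists T; split; first by lra.
suff ST : spread (x T) <= 0.
  move=> t Tt; apply: spread0; apply: Rle_antisym; last exact: spread_ge0.
  by apply: Rle_trans ST; apply: mono; lra.
apply: Rnot_lt_le => y0.
have y_le s : T0 <= s <= T -> spread (x T) <= spread (x s) by move=> ?; apply: mono; lra.
(* If the spread is still positive at [T], its square root stays at least [r0] before, where the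
   square root is Lipschitz with constant [/ r0]. Absolute continuity then survives, although the
   square root is not Lipschitz at 0. *)
pose r0 := sqrt (spread (x T)); have r00 : 0 < r0 by exact: sqrt_lt_R0.
have r_le s : T0 <= s <= T -> r0 <= sqrt (spread (x s)).
  by move=> /y_le ?; exact: sqrt_le_1_alt.
have : sqrt (spread (x T)) - sqrt (spread (x T0)) <= -1 * (T - T0).
  apply: (traj_le (h := fun t => sqrt (spread (x t)))); first by lra.
    apply: (abs_cont_lip (spread_ac (a := T0) (b := T) ltac:(lra)) (L := / r0)) => s t sT tT.
    have ra := r_le t tT; have rb := r_le s sT.
    have Ea := sqrt_sqrt _ (spread_ge0 (x t)); have Eb := sqrt_sqrt _ (spread_ge0 (x s)).
    rewrite -[in X in _ <= X]Ea -[in X in _ <= X]Eb.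
    move: (sqrt (spread (x t))) (sqrt (spread (x s))) ra rb {Ea Eb} => a b ra rb.
    have -> : a * a - b * b = (a + b) * (a - b) by ring.
    rewrite Rabs_mult [Rabs (a + b)]Rabs_pos_eq; last by lra.
    apply: (Rmult_le_reg_l r0) => //.
    rewrite -Rmult_assoc Rinv_r ?Rmult_1_l; last by lra.
    by apply: Rmult_le_compat_r; [exact: Rabs_pos | lra].
  move=> s v sT sv; have ys : 0 < spread (x s) by have := y_le s sT; lra.
  have ps : 0 < sqrt (spread (x s)) by exact: sqrt_lt_R0.
  eexists; split.
    apply: (derivable_pt_lim_comp (fun s => spread (x s)) sqrt).
      exact: (spread_derivable sv).
    exact: derivable_pt_lim_sqrt.
  apply: (Rmult_le_reg_l (2 * sqrt (spread (x s)))); first by lra.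
  rewrite -Rmult_assoc Rinv_r ?Rmult_1_l; last by lra.
  by have := decay s v ltac:(lra) sv; lra.
by have := sqrt_pos (spread (x T)); rewrite /T; lra.
Qed.

(** Beyond the radius [r], the linear lower bound is already at least the value at the origin, so a
    minimum over the ball is global. *)
Lemma team_min : exists s, forall u, team f s <= team f u.
Proof.
have [c [C [c0 growth]]] := uniform_growth.
have ct u : cont_at (team f) u.
  by apply: cont_at_sum => i _; exact: has_gradient_cont (f_grad i) u.
have gr u : c * norm u - INR n * C <= team f u.
  apply: (@Rle_trans _ (\big[Rplus/0]_(i < n) (c * norm u - C))).
    rewrite sumR_const card_ord.
    have : 0 <= c * norm u by apply: Rmult_le_pos; [lra | exact: norm_ge0].
    by nra.
  by apply: sumR_le => i _; exact: growth.
pose z := (fun=> 0) : 'I_m -> R.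
pose r := Rmax 0 ((team f z + INR n * C) / c).
have nz : norm z = 0 by apply/norm0P.
have r0 : 0 <= r by exact: Rmax_l.
have [s [_ smin]] : exists s, 0 <= 0 /\
    forall u, norm u <= r -> 0 <= 0 -> team f s <= team f u.
  apply: (attains_min (H := fun=> 0)) => //; first by move=> u; exact: cont_at_const.
  by exists z; split; lra.
exists s => u; have [ur|ru] := Rle_lt_dec (norm u) r; first by apply: smin => //; lra.
apply: Rle_trans (smin z _ _) _; try lra.
apply: Rle_trans (gr u).
have := Rmax_r 0 ((team f z + INR n * C) / c); rewrite -/r => H.
have : c * ((team f z + INR n * C) / c) = team f z + INR n * C by field; lra.
by have := Rmult_le_compat_l c _ _ (Rlt_le _ _ c0) (Rle_trans _ _ _ H (Rlt_le _ _ ru)); lra.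
Qed.

(** * Gradient flow of the average after consensus *)

Section Consensus.
Variable T : R.
Hypothesis T_ge0 : 0 <= T.
Hypothesis consensus : forall t, T <= t -> forall i j k, x t i k = x t j k.

Lemma avg_consensus t i : T <= t -> avg (x t) = x t i.
Proof. by move=> Tt; apply: avg_const => // *; exact: consensus. Qed.

(** Taken for [w] and its opposite, this is the gradient flow equation of the team function divided
    by [n], in weak form. *)
Lemma avg_velocity t v w : T <= t -> velocity t v ->
  dot w (avg (pos_of v)) <= - (/ INR n * \big[Rplus/0]_i dot w (g i (avg (x t)))).
Proof.
move=> Tt tv; rewrite dot_avg Ropp_mult_distr_r.
apply: Rmult_le_compat_l; first by apply/Rlt_le/Rinv_0_lt_compat; lra.
apply: Rle_trans (traj_mean w _ tv) _; first by lra.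
apply: Req_le; congr (- _); apply: eq_bigr => i _.
by rewrite (avg_consensus i Tt).
Qed.

Lemma team_avg_mono s t : T <= s <= t -> team f (avg (x t)) <= team f (avg (x s)).
Proof.
move=> st; have [B HB] := traj_bounded; have [L [L0 HL]] := gradient_bounded B.
suff : team f (avg (x t)) - team f (avg (x s)) <= 0 * (t - s) by lra.
apply: (traj_le (h := fun t => team f (avg (x t)))); first by lra.
  apply: (abs_cont_sum (z := fun i t => f i (avg (x t)))) => i.
  apply: (@abs_cont_dom _ (fun k t => avg (x t) k) _ L).
    by move=> k; apply: avg_ac; lra.
  move=> a b ra rb.
  (* After consensus the average is the position of an agent, so it inherits the bound [B]; the
     resulting gradient bound is the Lipschitz constant for absolute continuity. *)
  have bd r : s <= r <= t -> norm (g i (avg (x r))) <= L.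
    by move=> rr; apply: HL; rewrite (avg_consensus i0); [apply: HB | ]; lra.
  apply: Rle_trans (convex_lip (f_grad i) (@f_convex i) (bd b rb) (bd a ra)) _.
  by apply: Rmult_le_compat_l => //; exact: norm_le_sum.
move=> r v rt rv; exists (\big[Rplus/0]_i dot (g i (avg (x r))) (avg (pos_of v))); split.
  apply: (derivable_pt_lim_sum (F := fun i t => f i (avg (x t)))) => i.
  apply: (derivable_pt_lim_gradient (p := fun s => avg (x s)) (f_grad i)) => k.
  exact: avg_derivable.
(* [w] is the gradient of the team function, which therefore decreases at rate at least |w|^2 /
   n. *)
pose w k := \big[Rplus/0]_i g i (avg (x r)) k.
have sumw u : \big[Rplus/0]_i dot u (g i (avg (x r))) = dot u w by rewrite dot_sumr.
under eq_bigr => i _ do rewrite dotC.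
rewrite sumw dotC; apply: Rle_trans (avg_velocity w _ rv) _; first by lra.
rewrite sumw; have := dot_ge0 w.
by have := Rinv_0_lt_compat (INR n) ltac:(lra); nra.
Qed.

(* Along the gradient flow of the average, |avg - s|^2 decreases at rate at
   least 2/n times the optimality gap, which is itself nonincreasing; hence the
   gap is O(1/t). *)
Lemma team_avg_rate s t : T <= t -> (forall u, team f s <= team f u) ->
  2 * / INR n * (team f (avg (x t)) - team f s) * (t - T) <=
    dot (vsub (avg (x T)) s) (vsub (avg (x T)) s).
Proof.
move=> Tt smin; pose k := 2 * / INR n * (team f (avg (x t)) - team f s); rewrite -/k.
have : dot (vsub (avg (x t)) s) (vsub (avg (x t)) s) -
    dot (vsub (avg (x T)) s) (vsub (avg (x T)) s) <= (- k) * (t - T).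
  apply: (traj_le (h := fun t => dot (vsub (avg (x t)) s) (vsub (avg (x t)) s))).
  - by lra.
  - apply: abs_cont_sum => j; apply: abs_cont_sqr; first by lra.
    apply: (abs_cont_lip (avg_ac j (a := T) (b := t) ltac:(lra)) (L := 1)) => a b _ _.
    by rewrite /vsub; split_Rabs; lra.
  move=> r v rt rv; eexists; split.
    apply: (derivable_pt_lim_dot (p := fun t => vsub (avg (x t)) s) (w := avg (pos_of v))) => j.
    rewrite -[avg (pos_of v) j]Rminus_0_r.
    apply: derivable_pt_lim_minus (derivable_pt_lim_const _ _); exact: avg_derivable.
  have := @avg_velocity r v (vsub (avg (x r)) s) ltac:(lra) rv.
  have : team f (avg (x r)) - team f s <=
      \big[Rplus/0]_i dot (vsub (avg (x r)) s) (g i (avg (x r))).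
    rewrite /team -sumR_sub; apply: sumR_le => i _.
    exact: (convex_gradient_le (f_grad i) (@f_convex i)).
  have := @team_avg_mono r t ltac:(lra).
  have i0n := Rinv_0_lt_compat (INR n) ltac:(lra).
  rewrite /k; set A := \big[Rplus/0]_i _; set D := dot _ _ => H1 H2 H3.
  have : / INR n * (team f (avg (x t)) - team f s) <= / INR n * A.
    by apply: Rmult_le_compat_l; lra.
  by lra.
by have := dot_ge0 (vsub (avg (x t)) s); lra.
Qed.

Lemma team_avg_cvg s : (forall u, team f s <= team f u) ->
  forall eps, 0 < eps -> exists T', forall t, T' <= t ->
    Rabs (team f (avg (x t)) - team f s) < eps.
Proof.
move=> smin eps eps0; set D := dot (vsub (avg (x T)) s) (vsub (avg (x T)) s).
have D0 : 0 <= D by exact: dot_ge0.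
(* The gap is at most [n * D / (2 * (t - T))]; the added 1 makes this strictly less than [eps]. *)
exists (T + 1 + INR n * D / (2 * eps)) => t tT.
have nD : 0 <= INR n * D / (2 * eps).
  by apply: Rle_mult_inv_pos; [apply: Rmult_le_pos; lra | lra].
rewrite Rabs_pos_eq; last by have := smin (avg (x t)); lra.
apply: Rnot_le_lt => gap.
have := @team_avg_rate s t ltac:(lra) smin; rewrite -/D.
have H : INR n * D / (2 * eps) * (2 * eps) = INR n * D by field; lra.
set y := _ - team f s in gap *; move=> K.
have K2 : 2 * y * (t - T) <= INR n * D.
  have := Rmult_le_compat_l (INR n) _ _ ltac:(lra) K.
  by rewrite (_ : INR n * _ = 2 * y * (t - T)); [ | field; lra].
have : 2 * eps * (t - T) <= 2 * y * (t - T) by apply: Rmult_le_compat_r; lra.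
have : 2 * eps * (INR n * D / (2 * eps) + 1) <= 2 * eps * (t - T).
  by apply: Rmult_le_compat_l; lra.
by lra.
Qed.

End Consensus.

End Trajectory.

Theorem theorem1 (n m : nat) (G : R -> rel 'I_n) (dw : R)
    (f : 'I_n -> ('I_m -> R) -> R) (g : 'I_n -> ('I_m -> R) -> ('I_m -> R))
    (x : R -> 'I_n -> 'I_m -> R) (q : R -> 'I_n -> 'I_n -> R) :
  (forall i, convex_fun (f i)) ->
  (forall i, has_gradient (f i) (g i)) ->
  (forall i, continuous_map (g i)) ->
  (* (i) undirected and connected for all t >= 0 *)
  (forall t, 0 <= t -> forall i j, G t i j = G t j i) ->
  (forall t, 0 <= t -> forall i j, connect (G t) i j) ->
  (* (ii) X_i nonempty and bounded *)
  (forall i, (exists s, forall k, g i s k = 0) /\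
             bounded_set (fun s => forall k, g i s k = 0)) ->
  (* (iii) dwell time *)
  0 < dw -> dwell_time G dw ->
  (* initial gains *)
  (forall i j, q 0 i j = 0) ->
  (* (x, q) is a Filippov solution of the closed loop *)
  filippov_solution (closed_loop G g) (fun t => pack (x t) (q t)) ->
  (exists T, 0 <= T /\ forall t, T <= t -> forall i j k, x t i k = x t j k) /\
  (exists fstar,
     (exists s, team f s = fstar) /\ (forall s, fstar <= team f s) /\
     (forall eps, 0 < eps -> exists T, forall t, T <= t ->
        Rabs (team f (avg (x t)) - fstar) < eps)).
Proof.
move=> fC fG gC Gs Gc fM dw0 Gd q0 sol.
(* Without agents or without coordinates there is no index [i0] or [k0]. Consensus is then vacuous
   and the team function is constant. *)
have trivial : (forall s u : 'I_m -> R, team f s = team f u) ->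
    exists fstar, (exists s, team f s = fstar) /\ (forall s, fstar <= team f s) /\
     (forall eps, 0 < eps -> exists T, forall t, T <= t ->
        Rabs (team f (avg (x t)) - fstar) < eps).
  move=> tc; exists (team f (fun=> 0)); split; first by exists (fun=> 0).
  split=> [s|eps eps0]; first by rewrite (tc s (fun=> 0)); lra.
  by exists 0 => t _; rewrite (tc _ (fun=> 0)) Rminus_diag Rabs_R0.
have [i0 _|no_i] := pickP (@predT 'I_n); last first.
  split; first by exists 0; split=> [|t _ a]; [lra | have := no_i a].
  by apply: trivial => s u; apply: eq_bigr => a; have := no_i a.
have [k0 _|no_k] := pickP (@predT 'I_m); last first.
  split; first by exists 0; split=> [|t _ a b c]; [lra | have := no_k c].
  apply: trivial => s u; congr team.
  by apply: functional_extensionality => c; have := no_k c.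
have [T [T0 cons]] := finite_time_consensus fC fG gC Gs Gc fM dw0 Gd q0 sol i0 k0.
split; first by exists T.
have [s smin] := team_min fC fG fM i0.
exists (team f s); split; first by exists s.
split=> //.
exact: (team_avg_cvg fC fG gC Gs fM q0 sol i0 k0 T0 cons smin).
Qed.
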